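(* Let $p:=\mathbb{P}(X=Y)$. For any integer $m\ge 1$, there is a key-agreement scheme using $2$ rounds of interactive communication achieving the error-length pair $(\epsilon,\ell)$, where $\epsilon=(1-p)/m$ and $\ell=p\,(H(X\mid X=Y)-\log m-2)$.
   Context: Logarithms are base 2 and entropy is in bits. For $K\in\{0,1\}^*$ (finite bit sequences of any length), $|K|$ denotes its length, $K_n$ its $n$-th entry and $K^{n}=(K_1,\dots,K_n)$. A random $K\in\{0,1\}^*$ is a randomly-stopped bit sequence if $\mathbb{P}(K_n=k_n \mid |K|\ge n, K^{n-1}=k^{n-1})=1/2$ for all $n\ge 1$ and $k^n\in\{0,1\}^n$ with $\mathbb{P}(|K|\ge n, K^{n-1}=k^{n-1})>0$. $K$ is a conditionally randomly-stopped bit sequence given $W$ if $p_{K|W=w}$ is a randomly-stopped bit sequence distribution for every $w$ in the support of $W$. Key-agreement setting: $X,Y$ are correlated discrete random variables; Alice observes $X$, Bob observes $Y$; $G_A,G_B$ are local randomness with $(X,Y),G_A,G_B$ mutually independent. They alternate public messages $W_1$ (Alice, from $X,G_A$), $W_2$ (Bob, from $Y,G_B,W_1$), $W_3,\dots$ until stopping at time $N$. Alice outputs $K_A$ (function of $X,G_A,W^N$), Bob outputs $K_B$ (function of $Y,G_B,W^N$). The scheme achieves the error-length pair $(\epsilon,\ell)$ if there exists a random $K\in\{0,1\}^*$ jointly distributed with all these variables such that: $K$ is a conditionally randomly-stopped bit sequence given $W^N$; $\mathbb{P}(K_A=K_B=K)\ge 1-\epsilon$; and $\mathbb{E}[|K|\cdot\mathbf{1}\{K_A=K_B=K\}]\ge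 \ell$. *)

(* Defs.v *)
From HB Require Import structures.
From mathcomp Require Import all_boot all_order all_algebra.
From mathcomp Require Import all_classical all_reals.
From mathcomp Require Import ereal esum exp.
Set Implicit Arguments. Unset Strict Implicit. Unset Printing Implicit Defensive.
Import Order.TTheory GRing.Theory Num.Theory.
Local Open Scope classical_set_scope.
Local Open Scope ring_scope.

Definition log2 {R : realType} (x : R) : R := ln x / ln 2.

Definition is_pmf {R : realType} {T : choiceType} (f : T -> R) : Prop :=
  (forall t, 0 <= f t) /\ (\esum_(t in [set: T]) (f t)%:E = 1)%E.

Definition Pr {R : realType} {T : choiceType} (f : T -> R) (E : set T) : R :=
  fine (\esum_(t in E) (f t)%:E).

Definition entropy {R : realType} {T : choiceType} (f : T -> R) : \bar R :=
  \esum_(t in [set: T]) (- (f t * log2 (f t)))%:E.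

(* mu (a pmf on {0,1}^* = seq bool) is a randomly-stopped bit sequence
   distribution: for all n >= 1 and k^n, if P(|K| >= n, K^{n-1} = k^{n-1}) > 0
   then P(K_n = k_n | |K| >= n, K^{n-1} = k^{n-1}) = 1/2.
   (K^{j} = take j K, K_n = nth false K n.-1 since seq is 0-indexed.) *)
Definition randomly_stopped {R : realType} (mu : seq bool -> R) : Prop :=
  forall (n : nat) (s : seq bool), (1 <= n)%N -> size s = n ->
    let C := [set k : seq bool | (n <= size k)%N /\ take n.-1 k = take n.-1 s] in
    0 < Pr mu C ->
    Pr mu [set k | C k /\ nth false k n.-1 = nth false s n.-1] / Pr mu C
      = 1 / 2.

(* A two-round key-agreement scheme for the source PXY (alphabet T for both
   X and Y), described by:
   - local randomness G_A ~ PA on GA, G_B ~ PB on GB (independent of (X,Y)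
     and of each other),
   - W1 = w1 X G_A (Alice), W2 = w2 Y G_B W1 (Bob), N = 2,
   - K_A = kA X G_A W1 W2,  K_B = kB Y G_B W1 W2.
   It achieves (eps, ell) if there exists K jointly distributed with
   (X,Y,G_A,G_B) -- given by a conditional pmf q of K given (X,Y,G_A,G_B) --
   such that K is conditionally randomly stopped given W^2 = (W1,W2),
   P(K_A = K_B = K) >= 1 - eps and E[|K| 1{K_A = K_B = K}] >= ell. *)
Definition achieves2 {R : realType} {T GA GB W1T W2T : choiceType}
  (PXY : T * T -> R) (PA : GA -> R) (PB : GB -> R)
  (w1 : T -> GA -> W1T) (w2 : T -> GB -> W1T -> W2T)
  (kA : T -> GA -> W1T -> W2T -> seq bool)
  (kB : T -> GB -> W1T -> W2T -> seq bool)
  (eps : R) (ell : \bar R) : Prop :=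
  exists q : T * T * GA * GB -> seq bool -> R,
    (forall a, is_pmf (q a)) /\
    let Q := fun o : T * T * GA * GB * seq bool =>
      PXY (o.1.1.1.1, o.1.1.1.2) * PA o.1.1.2 * PB o.1.2 * q o.1 o.2 in
    let W := fun o : T * T * GA * GB * seq bool =>
      (w1 o.1.1.1.1 o.1.1.2, w2 o.1.1.1.2 o.1.2 (w1 o.1.1.1.1 o.1.1.2)) in
    let K := fun o : T * T * GA * GB * seq bool => o.2 in
    let KA := fun o : T * T * GA * GB * seq bool =>
      kA o.1.1.1.1 o.1.1.2 (W o).1 (W o).2 in
    let KB := fun o : T * T * GA * GB * seq bool =>
      kB o.1.1.1.2 o.1.2 (W o).1 (W o).2 in
    let good := [set o | KA o = K o /\ KB o = K o] in
    (forall w : W1T * W2T, 0 < Pr Q [set o | W o = w] ->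
       randomly_stopped (fun k => Pr Q [set o | K o = k /\ W o = w]
                                  / Pr Q [set o | W o = w])) /\
    1 - eps <= Pr Q good /\
    (ell <= \esum_(o in [set: T * T * GA * GB * seq bool])
              (Q o * (size (K o))%:R * (o \in good)%:R)%:E)%E.

(* Main.v *)
(* Write D x = P(X = Y = x). Alice publishes a complete prefix code w on finitely
   many symbols containing her X, drawn so that, given w and X = Y, the symbol x
   has probability 2^-|w(x)|; Bob answers whether Y is coded by w, and the key is
   the codeword. A hash T -> [m] with average collision probability at most 1/m
   exists by a greedy choice, and codes only contain symbols of one bin, which
   costs log m and bounds the error.

   If the entropy is finite, the source is truncated to a finite set and each bin
   is written as a mixture of dyadic sources by running Huffman's algorithm with
   random refinements; the gaps between the merged masses telescope, so the loss
   is at most one bit, and the second bit pays for the truncation. If the entropy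
   is infinite, codes of equal-length words on classes of symbols of comparable
   probability already give an infinite expected length. *)
Require Import Defs.
From HB Require Import structures.
From mathcomp Require Import all_boot all_order all_algebra finmap.
From mathcomp Require Import all_classical all_reals.
From mathcomp Require Import ereal esum exp.
From mathcomp Require Import topology normedtype sequences ring lra.
Import Order.TTheory GRing.Theory Num.Theory.
Local Open Scope classical_set_scope.
Local Open Scope ring_scope.
Set Implicit Arguments. Unset Strict Implicit. Unset Printing Implicit Defensive.

(** * Complete prefix codes *)

(** One fixed Huffman code would not do: its codeword consists of fair bits only if each symbol [x]
    has probability exactly [2^-|w(x)|], and the source is arbitrary. Randomizing over codes makes
    the posterior given the public code exactly dyadic. The price appears when masses [a <= b] are
    merged: a fair bit needs equal branches, so only mass [2 * a] can be split, and the remaining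
    [b - a] gets no bit from this merge.

    Bob's answer is what keeps the error small: if [Y] is not coded, both parties output the empty
    key and still agree, so a failure requires [X <> Y] inside one bin.

    The infinite case needs its own construction because the target is then [+oo]: a scheme for a
    truncated source has finite expected length, and a single scheme has to reach the bound. In the
    finite case no vanishing error term is allowed either, so the truncation tolerance is tied to
    the mass of a symbol that is kept. *)

Definition subtree_mass (R : realType) (B : seq (seq bool)) (u : seq bool) : R :=
  \sum_(c <- B | prefix u c) 2^-1 ^+ size c.

(** Equivalent to [B] being, without repetition, the set of leaves of a complete binary tree: if [u]
    has mass [2^-|u|], then either [u] is a word and nothing lies below it, or both children have
    mass [2^-(|u|+1)]. The second clause is the fairness of the next bit after [u]. *)
Definition full (R : realType) (B : seq (seq bool)) : Prop :=
  subtree_mass R B [::] = 1 /\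
  forall u, subtree_mass R B (rcons u false) = subtree_mass R B (rcons u true).

Definition word_law (R : realType) (B : seq (seq bool)) (k : seq bool) : R :=
  \sum_(c <- B | c == k) 2^-1 ^+ size c.

(** A symbol that [w] does not code gets the empty word, by the default of [nth]. *)
Definition word {T : choiceType} (w : seq (T * seq bool)) (x : T) : seq bool :=
  nth [::] (unzip2 w) (index x (unzip1 w)).

Lemma full_nil (R : realType) : full R [:: [::]].
Proof.
split=> [|u]; first by rewrite /subtree_mass big_cons big_nil /= addr0 expr0.
by rewrite /subtree_mass !big_cons !big_nil; case: u.
Qed.

Lemma perm_full (R : realType) (B B' : seq (seq bool)) :
  perm_eq B B' -> full R B -> full R B'.
Proof.
move=> BB' [h1 h2]; have e u : subtree_mass R B u = subtree_mass R B' u.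
  exact: perm_big.
by split=> [|u]; rewrite -!e.
Qed.

Lemma prefix_rcons_neq {A : eqType} (u k : seq A) (b b' : A) : u != k ->
  prefix (rcons u b) (rcons k b') = prefix (rcons u b) k.
Proof.
elim: u k => [|a u IH] [|c k] //=; rewrite ?prefix0s//.
  by case: u {IH} => [|? ?] /=; rewrite andbF.
by rewrite eqseq_cons; case: eqP => //= _ /IH.
Qed.

(** The two children of [k] together weigh as much as [k], so the only masses that change are those
    of the children themselves, which gain equal amounts. *)
Lemma full_split (R : realType) (B : seq (seq bool)) (k : seq bool) :
  full R (k :: B) -> full R [:: rcons k false, rcons k true & B].
Proof.
rewrite /full /subtree_mass => -[h1 h2]; split.
  move: h1; rewrite !big_cons /= !prefix0s !size_rcons !exprS => h.
  by lra.
move=> u; have := h2 u; rewrite !big_cons.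
have [->|uk] := eqVneq u k; last first.
  rewrite !prefix_rcons_neq// !size_rcons exprS.
  by case: ifP => _; case: ifP => _ // h; lra.
have np b b' : prefix (rcons k b) (rcons k b') = (b == b').
  by rewrite prefixE !size_rcons -(size_rcons k b') take_size eqseq_rcons eqxx eq_sym.
have nk b : prefix (rcons k b) k = false.
  apply/negbTE/negP => /size_prefix; rewrite size_rcons ltnn//.
by rewrite ?np ?nk /= !size_rcons => ->.
Qed.

Lemma full_join (R : realType) (B0 B1 : seq (seq bool)) :
  full R B0 -> full R B1 ->
  full R (map (cons false) B0 ++ map (cons true) B1).
Proof.
move=> [m0 h0] [m1 h1].
have e b u B : \sum_(c <- map (cons b) B | prefix u c) 2^-1 ^+ size c =
    if u is b' :: u' then (b' == b)%:R * (2^-1 * subtree_mass R B u')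
    else 2^-1 * subtree_mass R B [::].
  rewrite big_map; case: u => [|b' u'] /=.
    rewrite mulr_sumr; apply: eq_big => [i|i _]; first by rewrite !prefix0s.
    by rewrite exprS.
  case: eqP => _ /=; last by rewrite big_pred0// mul0r.
  by rewrite mul1r mulr_sumr; apply: eq_bigr => i _; rewrite exprS.
rewrite /full /subtree_mass; split.
  by rewrite big_cat /= !e m0 m1; field.
case=> [|b u]; rewrite !big_cat /= !e /=.
  by rewrite m0 m1 !mul0r !mul1r addr0 add0r.
by rewrite h0 h1.
Qed.

Lemma esum_word_law (R : realType) (B : seq (seq bool)) (E : set (seq bool)) :
  (\esum_(k in E) (word_law R B k)%:E)%E =
  (\sum_(c <- B | c \in E) 2^-1 ^+ size c : R)%:E.
Proof.
transitivity (\esum_(k in E) (\sum_(c <- B) ((c == k)%:R * 2^-1 ^+ size c : R)%:E))%E.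
  apply: eq_esum => k _; rewrite sumEFin /word_law big_mkcond /=; congr (_%:E).
  by apply: eq_bigr => c _; case: eqP => _; rewrite (mul1r, mul0r).
rewrite esum_sum; last by move=> *; rewrite lee_fin mulr_ge0// exprn_ge0.
rewrite [in RHS]big_mkcond -sumEFin /=; apply: eq_bigr => c _.
have [cE|cE] := boolP (c \in E).
  rewrite (esumID [set c])/=; last by move=> *; rewrite lee_fin mulr_ge0// exprn_ge0.
  rewrite setI1 cE esum_set1 ?eqxx ?mul1r ?lee_fin ?exprn_ge0//.
  rewrite esum1 ?adde0// => k [_ /= /eqP kc]; rewrite eq_sym (negbTE kc) mul0r//.
rewrite esum1// => k Ek; case: eqP => [ck|_]; last by rewrite mul0r.
by rewrite ck (mem_set Ek) in cE.
Qed.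

(** With [u] the first [n - 1] bits, the condition [n <= size k] excludes [k = u], so the
    conditioning event is the disjoint union of the subtrees at [u0] and [u1], whose masses
    agree. *)
Lemma word_law_randomly_stopped (R : realType) (B : seq (seq bool)) :
  full R B -> randomly_stopped (word_law R B).
Proof.
move=> [_ hB] n s n1 sn; set C := [set k | _ /\ _] => /=.
set u := take n.-1 s; have su : size u = n.-1.
  by rewrite size_takel// sn leq_pred.
have prefE b k : prefix (rcons u b) k =
    [&& (n <= size k)%N, take n.-1 k == u & nth false k n.-1 == b].
  rewrite prefixE size_rcons su prednK//.
  have [nk|nk] := leqP n (size k); last first.
    apply/eqP => /(congr1 size); rewrite size_rcons su prednK// take_oversize 1?ltnW// => e.
    by rewrite e ltnn in nk.
  rewrite -[in take n k](prednK n1) (take_nth false) ?prednK// eqseq_rcons.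
  by rewrite eq_sym.
have mE b : Pr (word_law R B) [set k | C k /\ nth false k n.-1 = b] =
    subtree_mass R B (rcons u b).
  rewrite /Pr esum_word_law /=; apply: eq_bigl => k; rewrite prefE.
  apply/idP/and3P; first by rewrite inE => -[[? /eqP ?] /eqP].
  by case=> ? /eqP ? /eqP ?; rewrite inE.
rewrite mE.
have -> : Pr (word_law R B) C =
    subtree_mass R B (rcons u false) + subtree_mass R B (rcons u true).
  rewrite -!mE /Pr !esum_word_law /= [LHS](bigID (fun k => nth false k n.-1)) /= addrC.
  congr (_ + _); apply: eq_bigl => k; apply/idP/idP.
  - by move=> /andP[+ /negbTE kb]; rewrite !inE.
  - by rewrite !inE => -[? ->]; rewrite andbT mem_set.
  - by move=> /andP[+ kb]; rewrite !inE.
  - by rewrite !inE => -[? ->]; rewrite andbT mem_set.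
rewrite hB; set q := subtree_mass _ _ _ => q0.
have -> : subtree_mass R B (rcons u (nth false s n.-1)) = q.
  by case: (nth _ _ _); rewrite /q ?hB.
have q00 : q != 0 by apply/eqP => z; rewrite z addr0 ltxx in q0.
by rewrite -mulr2n -[q *+ 2]mulr_natr invfM mulrA divff.
Qed.

(** * Huffman mixtures *)

Definition code_on (R : realType) {T : choiceType} (s : seq T)
    (w : seq (T * seq bool)) : Prop :=
  [/\ uniq (unzip1 w), {subset unzip1 w <= s} & full R (unzip2 w)].

(** [L] is an unnormalized mixture of codes. With [f] equal to [2^-|k|] this is the mass that the
    mixture gives to [x]; with the extra factor [|k|] it is the contribution of [x] to the expected
    key length. *)
Definition code_sum {R : realType} {T : choiceType}
    (L : seq (R * seq (T * seq bool))) (f : seq bool -> R) (x : T) : R :=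
  \sum_(p <- L | x \in unzip1 p.2) p.1 * f (word p.2 x).

Lemma word_cons {T : choiceType} (a x : T) (c : seq bool) w :
  word ((a, c) :: w) x = if a == x then c else word w x.
Proof. by rewrite /word /=; case: ifP. Qed.

Lemma word_rem {T : choiceType} (y x : T) (w : seq (T * seq bool)) :
  x != y -> word [seq p <- w | p.1 != y] x = word w x.
Proof.
move=> xy; elim: w => //= -[a c] w IH /=; rewrite word_cons.
case: eqVneq => /= [->|_]; last by rewrite word_cons IH.
by rewrite eq_sym (negbTE xy).
Qed.

Lemma perm_pull {T : choiceType} (w : seq (T * seq bool)) (y : T) :
  uniq (unzip1 w) -> y \in unzip1 w ->
  perm_eq w ((y, word w y) :: [seq p <- w | p.1 != y]).
Proof.
elim: w => //= -[a c] w IH /= /andP[aw uw]; rewrite inE word_cons.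
case: (eqVneq a y) => [<- _|ay /=].
  rewrite /= perm_cons; have /all_filterP -> // : all (fun p : T * seq bool => p.1 != a) w.
  by apply/allP => p pw; apply: contraNneq aw => <-; apply/mapP; exists p.
move=> /(IH uw) e.
rewrite -(perm_cons (a, c)) in e; apply: (perm_trans e).
by apply/permP => P /=; rewrite addnCA.
Qed.

(** The symbol [y] doubles as the name of the merged symbol in the smaller source, so undoing the
    merge extends the word of [y]. *)
Definition split_code {T : choiceType} (x y : T) (w : seq (T * seq bool)) :=
  [:: (x, rcons (word w y) false), (y, rcons (word w y) true)
    & [seq p <- w | p.1 != y]].

Lemma split_code_on (R : realType) {T : choiceType} (s : seq T) (x y : T)
    (w : seq (T * seq bool)) :
  uniq s -> x \in s -> y \in rem x s -> y \in unzip1 w ->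
  code_on R (rem x s) w -> code_on R s (split_code x y w).
Proof.
move=> us xs ys yw [uw sw fw].
have sub p : p \in w -> p.1 \in rem x s by move=> ?; apply: sw; apply/mapP; exists p.
have neq p : p \in w -> p.1 != x.
  by move/sub; rewrite mem_rem_uniq// inE => /andP[].
have xy : x != y by move: ys; rewrite mem_rem_uniq// inE eq_sym => /andP[].
split.
- rewrite /= inE (negbTE xy) /=; apply/and3P; split.
  + by apply/mapP => -[p]; rewrite mem_filter => /andP[_ /neq] /eqP + e; rewrite e.
  + by apply/mapP => -[p]; rewrite mem_filter => /andP[/eqP + _] e; rewrite e.
  + by apply: subseq_uniq uw; rewrite map_subseq// filter_subseq.
- move=> z; rewrite /= !inE => /or3P[/eqP->//|/eqP->|]; first exact: mem_rem ys.
  by move=> /mapP[p]; rewrite mem_filter => /andP[_ /sub] /mem_rem + ->.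
- apply: full_split; apply: perm_full fw.
  by have := perm_map (@snd _ _) (perm_pull uw yw).
Qed.

(** A binary choice has entropy at most one bit, here scaled by its mass [a + b]. It follows from
    [ln t <= t - 1] at [t = (a + b) / (2 * c)] for [c = a] and [c = b]. *)
Lemma neglog_split (R : realType) (a b : R) : 0 < a -> 0 < b ->
  - (a * log2 a) - b * log2 b <= (a + b) - (a + b) * log2 (a + b).
Proof.
move=> a0 b0; have ab0 : 0 < a + b by lra.
have l2 : 0 < ln (2 : R) by rewrite ln_gt0 ?ltr1n.
have key c : 0 < c -> c * (ln (a + b) - ln c - ln 2) <= (a + b) / 2 - c.
  move=> c0; rewrite -ln_div ?posrE// -ln_div ?posrE ?divr_gt0//.
  set t := _ / _ / 2; have t0 : 0 < t by rewrite !divr_gt0.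
  have -> : (a + b) / 2 - c = c * (t - 1) by rewrite /t; field; lra.
  rewrite ler_pM2l//.
  by have := @le_ln1Dx R (t - 1); rewrite [1 + _]addrC subrK; apply; lra.
have ka := key a a0; have kb := key b b0.
rewrite /log2 -subr_ge0.
have -> : a + b - (a + b) * (ln (a + b) / ln 2) - (- (a * (ln a / ln 2)) - b * (ln b /
  ln 2))
  = (a * ln a + b * ln b - (a + b) * ln (a + b) + (a + b) * ln 2) / ln 2.
  by field; lra.
by rewrite divr_ge0//; lra.
Qed.

Lemma arg_min_seq (R : realType) {T : choiceType} (s : seq T) (D : T -> R) :
  s != [::] -> exists2 x, x \in s & {in s, forall z, D x <= D z}.
Proof.
elim: s => // x [|y s] IH _.
  by exists x; rewrite ?inE// => z; rewrite inE => /eqP ->.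
have [//|z zs hz] := IH.
have [xz|zx] := leP (D x) (D z).
  exists x; first by rewrite inE eqxx.
  move=> t; rewrite inE => /predU1P[->//|/hz]; exact: le_trans.
exists z; first by rewrite inE zs orbT.
by move=> t; rewrite inE => /predU1P[->|/hz//]; exact: ltW.
Qed.

(* Huffman's algorithm: the two least likely symbols [a <= b] are merged; a code
   for the merged source is refined at the merged symbol with probability
   [2 a / (a + b)] and otherwise left to the likelier of the two symbols. The
   step wastes [b - a], and these gaps are disjoint intervals. *)
Lemma huffman_mixture (R : realType) {T : choiceType} (s : seq T) (D : T -> R) :
  s != [::] -> uniq s -> {in s, forall x, 0 < D x} ->
  exists L : seq (R * seq (T * seq bool)),
  [/\ {in L, forall p, 0 <= p.1 /\ code_on R s p.2},
      {in s, forall x, code_sum L (fun k => 2^-1 ^+ size k) x = D x} &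
      forall lam, {in s, forall x, lam <= D x} ->
      (\sum_(x <- s) D x) * log2 (\sum_(x <- s) D x)
       - \sum_(x <- s) D x * log2 (D x) - (\sum_(x <- s) D x - lam)
      <= \sum_(x <- s) code_sum L (fun k => 2^-1 ^+ size k * (size k)%:R) x].
Proof.
move: {2}(size s) (leqnn (size s)) => n; elim: n s D => [|n IH] s D.
  by rewrite leqn0 => /nilP ->.
move=> sn s0 us D0.
have [x xs xmin] := arg_min_seq D s0.
have ps := perm_to_rem xs.
set s' := rem x s in ps.
have us' : uniq s' by rewrite rem_uniq.
have [s'0|s'0] := eqVneq s' [::].
  rewrite s'0 in ps; have es : s = [:: x] by apply: perm_small_eq.
  exists [:: (D x, [:: (x, [::])])]; split.
  - move=> p; rewrite inE => /eqP ->; split; first by rewrite /= ltW ?D0.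
    by split=> //=; [rewrite es|exact: full_nil].
  - move=> z; rewrite es inE => /eqP ->.
    by rewrite /code_sum big_cons big_nil /= inE eqxx word_cons eqxx expr0 mulr1 addr0.
  - move=> lam hl; rewrite es !big_cons !big_nil !addr0.
    rewrite /code_sum big_cons big_nil /= inE eqxx word_cons eqxx /= !mulr0 addr0.
    by rewrite subrr; have := hl x xs; lra.
have [y ys' ymin] := arg_min_seq D s'0.
have ss' z : z \in s' -> z \in s by exact: mem_rem.
have ys := ss' _ ys'.
set a := D x; set b := D y.
have a0 : 0 < a by exact: D0.
have b0 : 0 < b by exact: D0.
have ab : a <= b by exact: xmin.
have ab0 : a + b != 0 by rewrite gt_eqF// addr_gt0.
have xy : x != y by move: ys'; rewrite mem_rem_uniq// inE eq_sym => /andP[].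
pose D' z := if z == y then a + b else D z.
have D'ge z : z \in s' -> b <= D' z.
  by rewrite /D'; case: eqP => [_ _|_]; [lra|exact: ymin].
have [||//|L' [codeL' massL' lenL']] := IH s' D' _ s'0.
- by rewrite size_rem// -ltnS (leq_trans _ sn)// prednK// lt0n size_eq0.
- exact: us'.
- by move=> z /D'ge; apply: lt_le_trans.
(* The merged symbol has mass [a + b]. The refined copies hold [2 * a] of it and give [a] to each of
   [x] and [y]; the unrefined copies give the remaining [b - a] to [y]. *)
pose split p : seq (R * seq (T * seq bool)) := if y \in unzip1 p.2 then
   [:: (p.1 * (2 * a / (a + b)), split_code x y p.2);
       (p.1 * ((b - a) / (a + b)), p.2)] else [:: p].
pose L := flatten (map split L').
have sumL f z : code_sum L f z = \sum_(p <- L') code_sum (split p) f z.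
  by rewrite /code_sum big_flatten big_map.
have xL' p : p \in L' -> x \notin unzip1 p.2.
  move=> /codeL'[_ [_ + _]] => sub; apply/negP => /sub.
  by rewrite mem_rem_uniq// inE eqxx.
have keysE p z : z != x -> (z \in unzip1 (split_code x y p)) = (z == y) || (z \in unzip1 p).
  move=> zx; rewrite /split_code /= !inE (negbTE zx) /=; case: eqVneq => //= zy.
  apply/mapP/mapP => -[q].
    by rewrite mem_filter => /andP[_ qp] ->; exists q.
  by move=> qp e; exists q => //; rewrite mem_filter -e zy.
have sumx f : code_sum L f x = 2 * a / (a + b) * code_sum L' (f \o rcons^~ false) y.
  rewrite sumL /code_sum mulr_sumr [RHS]big_mkcond /= !big_seq; apply: eq_bigr => p /xL' xp.
  rewrite /split; case: ifP => yp; rewrite !big_cons !big_nil /= ?(negbTE xp)//.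
  by rewrite inE eqxx /= word_cons eqxx addr0; ring.
have sumy f : code_sum L f y = 2 * a / (a + b) * code_sum L' (f \o rcons^~ true) y
    + (b - a) / (a + b) * code_sum L' f y.
  rewrite sumL /code_sum !mulr_sumr -big_split [RHS]big_mkcond /= !big_seq;
    apply: eq_bigr => p /xL' xp.
  rewrite /split; case: ifP => yp; rewrite !big_cons !big_nil /= ?yp//.
  rewrite keysE 1?eq_sym// eqxx /= /split_code !word_cons (negbTE xy) eqxx addr0; ring.
have sumz f z : z != x -> z != y -> code_sum L f z = code_sum L' f z.
  move=> zx zy; rewrite sumL /code_sum [RHS]big_mkcond /= !big_seq; apply: eq_bigr =>
    p /xL' xp.
  rewrite /split; case: ifP => yp; rewrite !big_cons !big_nil /= ?addr0//.
  rewrite keysE// (negbTE zy) /= /split_code !word_cons !(eq_sym _ z) (negbTE zx)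
    (negbTE zy).
  rewrite word_rem//; case: (z \in unzip1 p.2); rewrite ?addr0//.
  by field.
pose g1 (k : seq bool) : R := 2^-1 ^+ size k; pose g2 (k : seq bool) : R :=
  2^-1 ^+ size k * (size k)%:R.
have g1r c (z : T) : code_sum L' (g1 \o rcons^~ c) z = 2^-1 * code_sum L' g1 z.
  rewrite /code_sum mulr_sumr; apply: eq_bigr => p _ /=.
  by rewrite /g1 size_rcons exprS; ring.
have g2r c z : code_sum L' (g2 \o rcons^~ c) z =
  2^-1 * (code_sum L' g2 z + code_sum L' g1 z).
  rewrite /code_sum -big_split mulr_sumr; apply: eq_bigr => p _ /=.
  by rewrite /g1 /g2 size_rcons exprS -natr1; ring.
have mass_y : code_sum L' g1 y = a + b by rewrite [LHS]massL'// /D' eqxx.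
have neq z : z \in rem y s' -> z != x /\ z != y.
  rewrite mem_rem_uniq// inE => /andP[zy]; rewrite mem_rem_uniq// inE => /andP[zx _].
  by split.
exists L; split.
- move=> q /flattenP[_ /mapP[p pL ->]]; have [p0 cp] := codeL' _ pL.
  have cp' : code_on R s p.2.
    by case: cp => u1 u2 u3; split=> // z /u2 /ss'.
  rewrite /split; case: ifP => yp; last by rewrite inE => /eqP ->.
  rewrite !inE => /orP[] /eqP -> /=; split=> //.
  + by rewrite mulr_ge0// divr_ge0//; lra.
  + exact: split_code_on.
  + by rewrite mulr_ge0// divr_ge0//; lra.
- move=> z zs; rewrite -[LHS]/(code_sum L g1 z).
  have [->|zx] := eqVneq z x; first by rewrite sumx g1r mass_y /a; field.
  have [->|zy] := eqVneq z y; first by rewrite sumy g1r mass_y /b; field.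
  rewrite sumz// [LHS]massL' /D' ?(negbTE zy)//.
  by rewrite mem_rem_uniq// inE zx.
(* All masses of the merged source are at least [b], so its loss is at most the total minus [b].
   Undoing the merge adds at most [a + b] of entropy and exactly [2 * a] of length, so the loss
   grows by at most [b - a] and stays below the total minus [a], where [lam <= a]. *)
- move=> lam lamD; have := lenL' b D'ge.
  have ps2 := perm_to_rem ys'.
  have sumS (f : T -> R) : \sum_(z <- s) f z = f x + (f y + \sum_(z <- rem y s') f z).
    by rewrite (perm_big _ ps) big_cons (perm_big _ ps2) big_cons.
  have sumS' (f : T -> R) : \sum_(z <- s') f z = f y + \sum_(z <- rem y s') f z.
    by rewrite (perm_big _ ps2) big_cons.
  rewrite !sumS !sumS' -/a -/b.
  have D'E z : z \in rem y s' -> D' z = D z by rewrite /D' => /neq[_ /negbTE ->].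
  rewrite -/g2 (_ : D' y = a + b); last by rewrite /D' eqxx.
  rewrite [\sum_(z <- _) D' z](_ : _ = \sum_(z <- rem y s') D z); last first.
    by rewrite !big_seq; apply: eq_bigr => z /D'E.
  rewrite [\sum_(z <- _) (D' z * _)](_ : _ = \sum_(z <- rem y s') D z * log2 (D z));
    last first.
    by rewrite !big_seq; apply: eq_bigr => z /D'E ->.
  rewrite [\sum_(z <- _) code_sum L g2 z](_ : _ =
    \sum_(z <- rem y s') code_sum L' g2 z); last first.
    by rewrite !big_seq; apply: eq_bigr => z /neq[zx zy]; rewrite sumz.
  rewrite sumx sumy !g2r mass_y.
  set S := \sum_(z <- _) D z; set H := \sum_(z <- _) (_ * log2 _); set N := \sum_(z <- _) _.
  set n2 := code_sum L' g2 y.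
  have -> : 2 * a / (a + b) * (2^-1 * (n2 + (a + b))) +
     (2 * a / (a + b) * (2^-1 * (n2 + (a + b))) + (b - a) / (a + b) * n2 + N) =
     n2 + N + 2 * a by field.
  rewrite (addrA a b S) => h.
  have := neglog_split a0 b0; have := lamD x xs; rewrite -/a => *; lra.
Qed.

(** * Sums over arbitrary sets *)

Lemma subset_esum (R : realType) (T : choiceType) (A B : set T) (f : T -> \bar R) :
  A `<=` B -> (forall t, B t -> 0 <= f t)%E ->
  (\esum_(t in A) f t <= \esum_(t in B) f t)%E.
Proof.
move=> AB f0; rewrite [leRHS](esumID A)//.
have -> : B `&` A = A by apply/setIidPr.
by rewrite leeDl// esum_ge0// => t [/f0].
Qed.

Lemma esumZl (R : realType) (T : choiceType) (A : set T) (c : R) (f : T -> \bar R) :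
  0 <= c -> (forall t, 0 <= f t)%E ->
  (\esum_(t in A) (c%:E * f t) = c%:E * \esum_(t in A) f t)%E.
Proof.
move=> c0 f0.
have le d (g : T -> \bar R) : 0 <= d -> (forall t, 0 <= g t)%E ->
    (\esum_(t in A) (d%:E * g t) <= d%:E * \esum_(t in A) g t)%E.
  move=> d0 g0; apply: ge_ereal_sup => _ [X [finX XA] <-].
  rewrite -ge0_mule_fsumr//; apply: lee_wpmul2l; first by rewrite lee_fin.
  by apply: ereal_sup_ubound; exists X.
apply/eqP; rewrite eq_le le//=.
have [->|cn0] := eqVneq c 0; first by rewrite mul0e esum_ge0// => t _; rewrite mul0e.
have cp : 0 < c by rewrite lt_neqAle eq_sym cn0.
(* The converse inequality is [le] itself, applied to the factor [c^-1]. *)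
have ge : (\esum_(t in A) f t <= c^-1%:E * \esum_(t in A) (c%:E * f t))%E.
  apply: le_trans (le c^-1 (fun t => c%:E * f t)%E _ _).
  - by apply: le_esum => t _; rewrite muleA -EFinM mulVf// mul1e.
  - by rewrite invr_ge0.
  - by move=> t; rewrite mule_ge0// lee_fin.
apply: le_trans (lee_wpmul2l _ ge) _; first by rewrite lee_fin.
by rewrite muleA -EFinM divff// mul1e.
Qed.

Lemma esum_seq (R : realType) (T : choiceType) (s : seq T) (f : T -> \bar R) :
  uniq s -> (forall t, 0 <= f t)%E ->
  (\esum_(t in [set` s]) f t = \sum_(t <- s) f t)%E.
Proof.
move=> us f0; rewrite esum_fset; [|exact: finite_seq|by []].
exact/esym/fsbig_seq.
Qed.

Lemma esum_le1 (R : realType) (T : choiceType) (f : T -> R) (A : set T) :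
  is_pmf f -> (\esum_(t in A) (f t)%:E <= 1)%E.
Proof.
move=> [f0 <-]; apply: subset_esum => // t _; rewrite lee_fin//.
Qed.

Lemma Pr_EFin (R : realType) (T : choiceType) (f : T -> R) (A : set T) :
  is_pmf f -> (Pr f A)%:E = (\esum_(t in A) (f t)%:E)%E.
Proof.
move=> fP; rewrite fineK// ge0_fin_numE.
  by apply: le_lt_trans (esum_le1 A fP) _; rewrite ltry.
by apply: esum_ge0 => t _; rewrite lee_fin; case: fP.
Qed.

Lemma Pr_ge0 (R : realType) (T : choiceType) (f : T -> R) (A : set T) :
  (forall t, 0 <= f t) -> 0 <= Pr f A.
Proof. by move=> f0; rewrite fine_ge0// esum_ge0// => t _; rewrite lee_fin. Qed.

Lemma PrC (R : realType) (T : choiceType) (f : T -> R) (A : set T) :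
  is_pmf f -> Pr f (~` A) = 1 - Pr f A.
Proof.
move=> fP; have [f0 f1] := fP.
suff : Pr f A + Pr f (~` A) = 1 by move=> <-; rewrite addrC addKr.
apply: EFin_inj; rewrite EFinD !Pr_EFin// -f1 [RHS](esumID A) ?setTI//.
by move=> t _; rewrite lee_fin.
Qed.

Lemma esum_prod (R : realType) (S T : choiceType) (A : set S) (B : S -> set T)
    (f : S -> R) (g : S -> T -> R) :
  (forall s, 0 <= f s) -> (forall s t, 0 <= g s t) ->
  (\esum_(st in A `*`` B) (f st.1 * g st.1 st.2)%:E =
   \esum_(s in A) ((f s)%:E * \esum_(t in B s) (g s t)%:E))%E.
Proof.
move=> f0 g0; rewrite -(esum_esum (a := fun s t => (f s * g s t)%:E)).
  apply: eq_esum => s _; rewrite -esumZl//; last by move=> t; rewrite lee_fin.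
by move=> s t _ _; rewrite lee_fin mulr_ge0.
Qed.

Lemma map_word (T : choiceType) (w : seq (T * seq bool)) :
  uniq (unzip1 w) -> [seq word w x | x <- unzip1 w] = unzip2 w.
Proof.
elim: w => //= -[a c] w IH /= /andP[aw uw]; rewrite word_cons eqxx -[in RHS]IH//.
congr (_ :: _); apply/eq_in_map => x xw; rewrite word_cons.
by case: eqVneq aw xw => [->|//] /negP.
Qed.

Lemma is_pmf_point (R : realType) (T : choiceType) (x : T) :
  is_pmf (fun y => (y == x)%:R : R).
Proof.
split=> [t|]; first by [].
rewrite (esumID [set x]); last by move=> *; rewrite lee_fin.
rewrite setTI esum_set1 ?eqxx ?lee_fin// esum1 ?adde0// => y [_ /= /eqP yx].
by rewrite (negbTE yx).
Qed.

Lemma is_pmf_word_law (R : realType) (B : seq (seq bool)) :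
  full R B -> is_pmf (word_law R B).
Proof.
move=> [h _]; split=> [k|]; first by rewrite sumr_ge0// => c _; rewrite exprn_ge0.
rewrite esum_word_law; transitivity (subtree_mass R B [::])%:E; last by rewrite h.
congr (_%:E); apply: eq_bigl => c.
by rewrite prefix0s; apply/mem_set.
Qed.

(** * Achievability from codes *)

(** On [X = Y], the event that [w] is sent carries [C] times the codeword law. The test function [f]
    serves twice: the constant 1 gives the mass of the event, an indicator gives the law of the key
    on it. *)
Lemma code_diagonal_mass (R : realType) (T GA : choiceType) (PXY : T * T -> R)
    (PA : GA -> R) (w1 : T -> GA -> seq (T * seq bool))
    (w : seq (T * seq bool)) (C : R) (f : seq bool -> R) :
  (forall xy, 0 <= PXY xy) -> is_pmf PA -> (forall k, 0 <= f k) ->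
  uniq (unzip1 w) ->
  (forall x g, w1 x g = w -> x \in unzip1 w) ->
  (forall x, x \in unzip1 w -> PXY (x, x) * Pr PA [set g | w1 x g = w]
                             = C * 2^-1 ^+ size (word w x)) ->
  (\esum_(xg in [set xg | w1 xg.1 xg.2 = w])
     (PXY (xg.1, xg.1) * f (word w xg.1) * PA xg.2)%:E)%E =
  (C * \sum_(c <- unzip2 w) 2^-1 ^+ size c * f c)%:E.
Proof.
move=> P0 PA1 f0 uw keyw hC; have [PA0 _] := PA1.
rewrite [X in esum X _](_ : _ = [set` unzip1 w] `*`` (fun x => [set g | w1 x g = w]));
  last first.
  by apply/seteqP; split=> -[x g] /=; [move=> e; split=> //; apply: keyw e|case].
rewrite (esum_prod _ _ (f := fun x => PXY (x, x) * f (word w x)) (g := fun _ g =>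
  PA g))//; last first.
  by move=> x; rewrite mulr_ge0.
rewrite esum_seq//; last first.
  by move=> x; rewrite mule_ge0// ?lee_fin ?mulr_ge0// esum_ge0// => g _; rewrite lee_fin.
rewrite -(map_word uw) [in RHS]big_map mulr_sumr -sumEFin !big_seq; apply: eq_bigr => x xw.
rewrite -Pr_EFin// -EFinM; congr (_%:E).
by rewrite mulrAC hC//; ring.
Qed.

(* The ideal key [K] is the common codeword when [X = Y]; when [X <> Y] passes
   Bob's test, [K] is redrawn from the codeword law, so that [K] given the public
   messages always follows the law of a complete prefix code. *)
Lemma codes_achieve (R : realType) (T GA : choiceType) (PXY : T * T -> R)
    (PA : GA -> R) (w1 : T -> GA -> seq (T * seq bool)) (eps : R) (ell : \bar R) :
  is_pmf PXY -> is_pmf PA ->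
  (forall x g, w1 x g != [::] ->
     [/\ x \in unzip1 (w1 x g), uniq (unzip1 (w1 x g)) & full R (unzip2 (w1 x g))]) ->
  (forall w, exists C, forall x, x \in unzip1 w ->
     PXY (x, x) * Pr PA [set g | w1 x g = w] = C * 2^-1 ^+ size (word w x)) ->
  Pr PXY [set xy | xy.1 <> xy.2 /\ exists g, xy.2 \in unzip1 (w1 xy.1 g)] <= eps ->
  (ell <= \esum_(xg in [set: T * GA])
     (PXY (xg.1, xg.1) * PA xg.2 * (size (word (w1 xg.1 xg.2) xg.1))%:R)%:E)%E ->
  achieves2 PXY PA (fun _ : unit => 1) w1 (fun y _ w => y \in unzip1 w)
    (fun x _ w b => if b then word w x else [::])
    (fun y _ w b => if b then word w y else [::]) eps ell.
Proof.
move=> PXY1 PA1 codew massw collw lenw.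
have [P0 P1] := PXY1; have [PA0 PA11] := PA1.
pose q (a : T * T * GA * unit) (k : seq bool) : R :=
  if a.1.1.2 \notin unzip1 (w1 a.1.1.1 a.1.2) then (k == [::])%:R
  else if a.1.1.1 == a.1.1.2 then (k == word (w1 a.1.1.1 a.1.2) a.1.1.1)%:R
  else word_law R (unzip2 (w1 a.1.1.1 a.1.2)) k.
have q1 a : is_pmf (q a).
  have [ya|ya] := boolP (a.1.1.2 \in unzip1 (w1 a.1.1.1 a.1.2)); last first.
    rewrite (_ : q a = fun k => (k == [::])%:R); first exact: is_pmf_point.
    by apply/funext => k; rewrite /q ya.
  have [xy|xy] := boolP (a.1.1.1 == a.1.1.2).
    rewrite (_ : q a = fun k => (k == word (w1 a.1.1.1 a.1.2) a.1.1.1)%:R).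
      exact: is_pmf_point.
    by apply/funext => k; rewrite /q ya xy.
  rewrite (_ : q a = word_law R (unzip2 (w1 a.1.1.1 a.1.2))); last first.
    by apply/funext => k; rewrite /q ya (negbTE xy).
  apply: is_pmf_word_law; case: (codew a.1.1.1 a.1.2) => //.
  by apply: contraTneq ya => ->.
exists q; split=> // Q W K KA KB good.
pose A (a : T * T * GA * unit) : R := PXY (a.1.1.1, a.1.1.2) * PA a.1.2 * 1.
have A0 a : 0 <= A a by rewrite /A mulr1 mulr_ge0.
have QE a k : Q (a, k) = A a * q a k by [].
have q0 a k : 0 <= q a k by case: (q1 a).
have Q0 o : 0 <= Q o by case: o => a k; rewrite QE mulr_ge0.
have QK E k : (\esum_(o in [set o | K o = k /\ E o.1]) (Q o)%:E =
    \esum_(a in E) (A a * q a k)%:E)%E.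
  rewrite -(esum_image E (fun a => (a, k)) (fun o => (Q o)%:E)); last first.
    by move=> a b _ _ [].
  congr (esum _ _); apply/seteqP; split=> [[a k'] [/= kk Ea]|o [a Ea <-]//].
  by exists a => //; rewrite -kk.
have QE' E : (\esum_(o in [set o | E o.1]) (Q o)%:E = \esum_(a in E) (A a)%:E)%E.
  rewrite [X in esum X _](_ : _ = E `*`` (fun=> setT)); last first.
    by apply/seteqP; split=> -[a k] //= [].
  rewrite (esum_prod _ _ (f := A) (g := q))//; apply: eq_esum => a _.
  by case: (q1 a) => _ ->; rewrite mule1.
have esumA (E : set (T * T)) : (\esum_(a in [set a | E a.1.1]) (A a)%:E =
    \esum_(xy in E) (PXY xy)%:E)%E.
  pose e (xyg : T * T * GA) := (xyg, tt).
  have -> : [set a : T * T * GA * unit | E a.1.1] = e @` (E `*`` (fun=> [set: GA])).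
    apply/seteqP; split=> [[[xy g] []] /= ?|_ [[xy g] [/= ? _] <-]//].
    by exists (xy, g).
  rewrite esum_image; last by move=> a b _ _ [].
  transitivity (\esum_(xyg in E `*`` (fun=> [set: GA])) (PXY xyg.1 * PA xyg.2)%:E)%E.
    by apply: eq_esum => -[[x y] g] _; rewrite /A /= mulr1.
  rewrite (esum_prod _ _ (f := PXY) (g := fun=> PA))//.
  by apply: eq_esum => xy _; rewrite PA11 mule1.
have Q1 : is_pmf Q.
  split=> //; have := QE' setT; rewrite (esumA setT) P1 => <-.
  by congr (esum _ _); apply/seteqP; split.
split; last split.
- move=> [w b] ZW.
  pose E : set (T * T * GA * unit) := [set a |
    (w1 a.1.1.1 a.1.2, a.1.1.2 \in unzip1 (w1 a.1.1.1 a.1.2)) = (w, b)].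
  have EW : Pr Q [set o | W o = (w, b)] = fine (\esum_(a in E) (A a)%:E)%E.
    by rewrite -QE'.
  have EK k : Pr Q [set o | K o = k /\ W o = (w, b)] =
      fine (\esum_(a in E) (A a * q a k)%:E)%E by rewrite -QK.
  have Zfin : (\esum_(a in E) (A a)%:E)%E \is a fin_num.
    by rewrite -QE' -Pr_EFin.
  suff [B fB hB] : exists2 B, full R B &
      forall k, Pr Q [set o | K o = k /\ W o = (w, b)] =
                Pr Q [set o | W o = (w, b)] * word_law R B k.
    rewrite (_ : (fun k => _) = word_law R B); first exact: word_law_randomly_stopped.
    by apply/funext => k; rewrite hB mulrAC divff ?mul1r// gt_eqF.
  case: b @E ZW EW EK Zfin => E ZW EW EK Zfin; last first.
    (* After Bob's rejection the key is constantly empty, which is the law of the code with a single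
       leaf. *)
    exists [:: [::]]; first exact: full_nil.
    move=> k; rewrite EK EW.
    have -> : (\esum_(a in E) (A a * q a k)%:E =
        \esum_(a in E) ((word_law R [:: [::]] k)%:E * (A a)%:E))%E.
      apply: eq_esum => a [_ ya]; rewrite /q ya /= mulrC; congr (_ * _)%:E.
      rewrite /word_law big_cons big_nil eq_sym.
      by case: ifP => //=; rewrite addr0 expr0.
    have wl0 : 0 <= word_law R [:: [::]] k.
      by have [+ _] := is_pmf_word_law (full_nil R); apply.
    rewrite esumZl//.
    by rewrite fineM//= mulrC.
  have [a0 Ea0] : exists a, E a.
    apply: contrapT => nE; move: ZW; rewrite EW.
    rewrite (_ : E = set0) ?esum_set0 ?ltxx//.
    by apply/seteqP; split=> // a Ea; case: nE; exists a.
  have [w_ya0 ya0] : w1 a0.1.1.1 a0.1.2 = w /\ a0.1.1.2 \in unzip1 w.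
    by case: Ea0 => ->.
  have wn0 : w != [::] by apply: contraTneq ya0 => ->.
  have [_ uw fw] : [/\ a0.1.1.1 \in unzip1 w, uniq (unzip1 w) & full R (unzip2 w)].
    by have := codew a0.1.1.1 a0.1.2; rewrite w_ya0; apply.
  have keyw x g : w1 x g = w -> x \in unzip1 w.
    by move=> e; have := codew x g; rewrite e => -[].
  have [C hC] := massw w.
  exists (unzip2 w) => // k; rewrite EK EW.
  (* The event that [w] is sent and accepted splits into [X = Y], where the key has the word law by
     the dyadic masses, and [X <> Y], where it has that law by the redraw. The proportion of the two
     parts is therefore irrelevant. *)
  pose D := [set a : T * T * GA * unit | a.1.1.1 = a.1.1.2].
  have diag (f : seq bool -> R) : (forall k, 0 <= f k) ->
     (\esum_(a in E `&` D) (A a * f (word w a.1.1.1))%:E)%E =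
     (C * \sum_(c <- unzip2 w) 2^-1 ^+ size c * f c)%:E.
    move=> f0; pose e (xg : T * GA) := (xg.1, xg.1, xg.2, tt).
    have -> : E `&` D = e @` [set xg | w1 xg.1 xg.2 = w].
      apply/seteqP; split=> [[[[x y] g] []]|_ [[x g] /= xw <-]].
        case=> -[/= xw _]; rewrite /D /= => xy.
        by exists (x, g) => //; rewrite /e /= -xy.
      by split=> //; rewrite /E /= xw (keyw _ _ xw).
    rewrite esum_image; last by move=> [x g] [x' g'] _ _ /= [-> _ ->].
    rewrite -(code_diagonal_mass P0 PA1 f0 uw keyw hC); apply: eq_esum => xg _.
    by rewrite /A /e /= mulr1 mulrAC.
  have wl0 k' : 0 <= word_law R (unzip2 w) k'.
    by have [+ _] := is_pmf_word_law fw; apply.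
  have Mfin : (\esum_(a in E `&` ~` D) (A a)%:E)%E \is a fin_num.
    rewrite ge0_fin_numE; last by apply: esum_ge0 => a _; rewrite lee_fin.
    apply: le_lt_trans (subset_esum (B := E) _ _) _ => [a []//|a _|].
      by rewrite lee_fin.
    by rewrite -ge0_fin_numE//; apply: esum_ge0 => a _; rewrite lee_fin.
  have e1 : (\esum_(a in E) (A a)%:E = C%:E + \esum_(a in E `&` ~` D) (A a)%:E)%E.
    rewrite [LHS](esumID D); last by move=> a _; rewrite lee_fin.
    congr (_ + _)%E; have := diag (fun=> 1) (fun=> ler01).
    rewrite (_ : \sum_(c <- _) _ = 1); last first.
      transitivity (subtree_mass R (unzip2 w) [::]); last by case: fw.
      by apply: eq_big => [c|c _]; rewrite ?prefix0s ?mulr1.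
    by rewrite mulr1 => <-; apply: eq_esum => a _; rewrite mulr1.
  have e2 : (\esum_(a in E) (A a * q a k)%:E = (C * word_law R (unzip2 w) k)%:E
      + (word_law R (unzip2 w) k)%:E * \esum_(a in E `&` ~` D) (A a)%:E)%E.
    rewrite [LHS](esumID D); last by move=> a _; rewrite lee_fin mulr_ge0.
    congr (_ + _)%E.
      rewrite (_ : word_law _ _ _ = \sum_(c <- unzip2 w) 2^-1 ^+ size c * (k == c)%:R);
        last first.
        rewrite /word_law big_mkcond; apply: eq_bigr => c _; rewrite eq_sym.
        by case: eqP => _; rewrite (mulr1, mulr0).
      rewrite -(diag (fun c => (k == c)%:R))//; apply: eq_esum => a [[aw ya] ad].
      by rewrite /q ya aw /= ad eqxx.
    rewrite -esumZl//.
    apply: eq_esum => a [[aw ya] /eqP ad].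
    by rewrite /q ya /= (negbTE ad) aw mulrC.
  rewrite e1 e2 fineD// ?fineM// ?fin_numM// fineD//= mulrDl; congr (_ + _); exact: mulrC.
(* Outside [Coll], either Bob rejects or [X = Y]; in both cases [q] is concentrated on the single
   key [kd], which both parties output. The graph of [kd] thus carries the full mass of the
   complement. *)
- pose Coll := [set xy : T * T | xy.1 <> xy.2 /\ exists g, xy.2 \in unzip1 (w1 xy.1 g)].
  apply: (@le_trans _ _ (Pr PXY (~` Coll))); first by rewrite PrC// lerD2l lerN2.
  rewrite -lee_fin !Pr_EFin// -esumA.
  pose kd (a : T * T * GA * unit) := if a.1.1.2 \in unzip1 (w1 a.1.1.1 a.1.2)
    then word (w1 a.1.1.1 a.1.2) a.1.1.1 else [::].
  pose e a := (a, kd a).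
  apply: le_trans (subset_esum (A := e @` [set a | (~` Coll) a.1.1]) _ _); last first.
  + by move=> o _; rewrite lee_fin.
  + move=> _ [[[[x y] g] u] nC <-]; rewrite /good /KA /KB /K /W /e /kd /=.
    case: ifPn => // yw; suff -> : x = y by [].
    by apply: contrapT => xy; apply: nC; split=> //; exists g.
  rewrite esum_image; last by move=> a b _ _ [].
  apply: le_esum => -[[[x y] g] u] nC; rewrite QE lee_fin /q /kd /=.
  case: (boolP (y \in unzip1 (w1 x g))) => yw /=; last by rewrite mulr1.
  suff -> : x = y by rewrite !eqxx mulr1.
  by apply: contrapT => xy; apply: nC; split=> //; exists g.
- apply: le_trans lenw _.
  pose e (xg : T * GA) : T * T * GA * unit * seq bool :=
    (xg.1, xg.1, xg.2, tt, word (w1 xg.1 xg.2) xg.1).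
  apply: le_trans (subset_esum (A := e @` setT) _ _) => //; last first.
    by move=> o _; rewrite lee_fin !mulr_ge0.
  rewrite esum_image; last by move=> [x g] [x' g'] _ _ [-> _ ->].
  apply: le_esum => -[x g] _; rewrite QE lee_fin.
  (* The only message that omits Alice's own symbol is the empty code, so a rejection on the
     diagonal yields the same empty key. *)
  have nx : x \notin unzip1 (w1 x g) -> word (w1 x g) x = [::].
    by have [->//|/codew[-> ]] := eqVneq (w1 x g) [::].
  have -> : (e (x, g) \in good) = true.
    apply/mem_set; rewrite /good /KA /KB /K /W /e /=.
    by case: ifPn => // /nx ->.
  have -> : q (x, x, g, tt) (word (w1 x g) x) = 1.
    by rewrite /q /= eqxx; case: ifPn => [/nx ->|_]; rewrite eqxx.
  by rewrite /A /= !mulr1.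
Qed.

(** * Hashing *)

Lemma finite_superlevel (R : realType) (T : choiceType) (f : T -> R) (c : R) :
  is_pmf f -> 0 < c -> finite_set [set t | c <= f t].
Proof.
move=> fP c0; have [f0 _] := fP.
have [n nP] := ltr_add_invr c0; rewrite add0r in nP.
apply: contrapT => /(infinite_set_fset n.+2)[B BA nB].
have := esum_le1 [set` B] fP; rewrite esum_fset//; last by move=> i _; rewrite lee_fin.
rewrite fsbig_finite//= set_fsetK sumEFin lee_fin; apply/negP; rewrite -ltNge.
apply: (@lt_le_trans _ _ (\sum_(i <- B) n.+1%:R^-1)).
  rewrite big_const_seq count_predT iter_addr_0 -[ltRHS]mulr_natl.
  rewrite ltr_pdivlMr// mul1r ltr_nat; exact: nB.
rewrite big_seq [leRHS]big_seq; apply: ler_sum => i /BA /=; apply: le_trans; exact: ltW.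
Qed.

Lemma countable_support (R : realType) (T : choiceType) (f : T -> R) :
  is_pmf f -> countable [set t | 0 < f t].
Proof.
move=> fP.
have -> : [set t | 0 < f t] = \bigcup_n [set t | n.+1%:R^-1 <= f t].
  apply/seteqP; split=> t /=; last by case=> n _ /=; apply: lt_le_trans; rewrite invr_gt0.
  move=> ft; have [n nP] := ltr_add_invr ft.
  by exists n => //=; rewrite add0r in nP; exact: ltW.
apply: bigcup_countable => // n _; apply: finite_set_countable.
by apply: finite_superlevel; rewrite ?invr_gt0.
Qed.

Lemma pigeonhole_esum (R : realType) (T : choiceType) (m : nat) (A : set T)
    (f : T -> R) (col : T -> 'I_m) :
  (0 < m)%N -> (forall t, 0 <= f t) -> (\esum_(t in A) (f t)%:E < +oo)%E ->
  exists b, (m%:R%:E * (\esum_(t in A `&` [set t | col t = b]) (f t)%:E)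
             <= \esum_(t in A) (f t)%:E)%E.
Proof.
move=> m0 f0 fin.
pose s b := fine (\esum_(t in A `&` [set t | col t = b]) (f t)%:E)%E.
have sE b : (\esum_(t in A `&` [set t | col t = b]) (f t)%:E = (s b)%:E)%E.
  rewrite /s fineK// ge0_fin_numE; last by apply: esum_ge0 => t _; rewrite lee_fin.
  by apply: le_lt_trans fin; apply: subset_esum => [t []|t _]; rewrite ?lee_fin.
have AE : (\esum_(t in A) (f t)%:E = (\sum_b s b)%:E)%E.
  transitivity (\esum_(t in A) \sum_(b : 'I_m) (if t \in [set t | col t =
    b] then (f t)%:E else 0))%E.
    apply: eq_esum => t _; rewrite (bigD1 (col t))//= mem_set// big1 ?adde0//.
    by move=> b bt; rewrite memNset //= => e; rewrite e eqxx in bt.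
  rewrite esum_sum; last by move=> t b _ _; case: ifP => // _; rewrite lee_fin.
  by rewrite -sumEFin; apply: eq_bigr => b _; rewrite -esum_mkcondr sE.
apply: contrapT => /forallNP nb.
have lt b : \sum_b s b < m%:R * s b.
  by have := nb b; rewrite AE sE -EFinM lee_fin => /negP; rewrite -ltNge.
suff : m%:R * (\sum_b s b) < m%:R * (\sum_b s b) by rewrite ltxx.
rewrite [ltRHS]mulr_sumr.
have -> : m%:R * \sum_b s b = \sum_(b : 'I_m) \sum_b s b.
  by rewrite sumr_const card_ord mulr_natl.
apply: ltr_sum => //; apply/hasP; exists (Ordinal m0) => //.
Qed.

(* Symbols are hashed greedily along an enumeration of the support: each one
   goes to the bin that collides least with the symbols hashed before it. *)
Lemma greedy_hash (R : realType) (T : choiceType) (m : nat) (e : T -> nat)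
    (w : T -> T -> R) :
  (0 < m)%N -> (forall x y, 0 <= w x y) ->
  (forall x, \esum_(y in [set: T]) (w x y)%:E < +oo)%E ->
  exists h : T -> 'I_m, forall x,
    (m%:R%:E * (\esum_(y in [set y | (e y < e x)%N /\ h y = h x]) (w x y)%:E)
     <= \esum_(y in [set y | (e y < e x)%N]) (w x y)%:E)%E.
Proof.
move=> m0 w0 fin.
have pig x (col : T -> 'I_m) :=
  @pigeonhole_esum R T m [set y | (e y < e x)%N] (w x) col m0 (w0 x).
have {}pig x (col : T -> 'I_m) : exists b,
    (m%:R%:E * (\esum_(y in [set y | (e y < e x)%N] `&` [set y | col y = b]) (w x y)%:E)
     <= \esum_(y in [set y | (e y < e x)%N]) (w x y)%:E)%E.
  apply: pig; apply: le_lt_trans (fin x); apply: subset_esum => // y _.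
  by rewrite lee_fin.
pose best x col := projT1 (cid (pig x col)).
(* [H n] is final on the symbols of index below [n]. The initial bin is a placeholder: the bound for
   [x] only reads the bins of symbols of smaller index. *)
pose H := fix H n : T -> 'I_m := if n is n'.+1 then
  fun y => if e y == n' then best y (H n') else H n' y else fun=> Ordinal m0.
pose h y := best y (H (e y)).
have Hh n y : (e y < n)%N -> H n y = h y.
  elim: n => // n IH; rewrite ltnS leq_eqVlt /= => /predU1P[yn|yn].
    by rewrite yn eqxx /h yn.
  by rewrite ltn_eqF// IH.
exists h => x; have := projT2 (cid (pig x (H (e x)))); rewrite -/(best _ _) -/(h x).
apply: le_trans; apply: lee_wpmul2l; first by rewrite lee_fin.
apply: subset_esum => [y [/= yx hyx]|y _]; last by rewrite lee_fin.
by split=> //=; rewrite Hh.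
Qed.

Lemma hash_exists (R : realType) (T : choiceType) (PXY : T * T -> R) (m : nat) :
  is_pmf PXY -> (0 < m)%N -> exists h : T -> 'I_m,
  Pr PXY [set xy | xy.1 <> xy.2 /\ h xy.1 = h xy.2] <=
  (1 - Pr PXY [set xy | xy.1 = xy.2]) / m%:R.
Proof.
move=> PXY1 m0; have [P0 P1] := PXY1.
(* [T] may be uncountable, so only the coordinates of points of positive mass are enumerated;
   distinct symbols with the same index then form pairs of mass zero. *)
have [e einj] : exists e : T -> nat, forall x y, 0 < PXY (x, y) -> e x = e y -> x = y.
  pose S := [set xy | 0 < PXY xy].
  have /countable_injP[e einj] : countable (\bigcup_(xy in S) [set xy.1; xy.2]).
    apply: bigcup_countable => [|xy _]; first exact: countable_support.
    by apply: finite_set_countable; rewrite finite_setU.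
  exists e => x y xy; apply: einj; apply/mem_set; exists (x, y) => //=; [left|right]; by [].
pose w x y := PXY (x, y) + PXY (y, x).
have w0 x y : 0 <= w x y by rewrite addr_ge0.
(* Both orders of a pair are charged to its symbol of larger index. Taking for [P] equality of bins
   gives the collision probability, taking [True] gives the probability of [X <> Y], and the greedy
   bound compares the two term by term. *)
have sym (P : T -> T -> Prop) : (forall x y, P x y -> P y x) ->
    (\esum_(xy in [set xy | xy.1 <> xy.2 /\ P xy.1 xy.2]) (PXY xy)%:E =
     \esum_(x in [set: T]) \esum_(y in [set y | (e y < e x)%N /\ P y x]) (w x y)%:E)%E.
  move=> Psym.
  pose O := [set xy : T * T | (e xy.2 < e xy.1)%N /\ P xy.2 xy.1].
  pose sw (xy : T * T) := (xy.2, xy.1).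
  rewrite esum_esum; last by move=> *; rewrite lee_fin.
  rewrite [X in _ = esum X _](_ : _ = O); last by apply/seteqP; split=> -[x y] //= [].
  transitivity (\esum_(xy in O) (PXY xy)%:E + \esum_(xy in O) (PXY (sw xy))%:E)%E;
    last first.
    rewrite -esumD; [|by move=> *; rewrite lee_fin..].
    by apply: eq_esum => -[x y] _.
  rewrite -(esum_image O sw (fun xy => (PXY xy)%:E)); last first.
    by move=> [x y] [x' y'] _ _ [-> ->].
  rewrite (esumID O); last by move=> *; rewrite lee_fin.
  congr (_ + _)%E.
    congr (esum _ _); apply/seteqP; split=> [xy [_]//|[x y] [/= yx Pyx]]; split=> //.
    by split=> [/= xy|]; [rewrite xy ltnn in yx|exact: Psym].
  rewrite (esumID (sw @` O)); last by move=> *; rewrite lee_fin.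
  rewrite [X in (_ + X)%E]esum1 ?adde0.
    congr (esum _ _); apply/seteqP; split=> [xy [_]//|_ [[x y] [/= yx Pyx] <-]].
    split; last by exists (x, y).
    split; last by case=> /= /ltn_trans /(_ yx); rewrite ltnn.
    by split=> //= xy; rewrite xy ltnn in yx.
  move=> [x y] [[[/= xy Pxy] nO] nsO].
  have := P0 (x, y); rewrite le_eqVlt => /predU1P[<-//|Ppos].
  case: (ltngtP (e x) (e y)) => exy.
  - by case: nsO; exists (y, x) => //; split.
  - by case: nO; split=> //; exact: Psym.
  - by case: xy; exact: einj Ppos exy.
have [|h hP] := @greedy_hash R T m e w m0 w0.
  move=> x; apply: (@le_lt_trans _ _ (1 + 1)%E); last by rewrite ltry.
  rewrite (eq_esum (b := fun y => ((PXY (x, y))%:E + (PXY (y, x))%:E)%E))//.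
  rewrite esumD; [|by move=> *; rewrite lee_fin..].
  apply: leeD.
    rewrite -(esum_image setT (fun y => (x, y)) (fun xy => (PXY xy)%:E));
      last by move=> a b _ _ [].
    exact: esum_le1.
  rewrite -(esum_image setT (fun y => (y, x)) (fun xy => (PXY xy)%:E));
    last by move=> a b _ _ [].
  exact: esum_le1.
exists h; rewrite -PrC// ler_pdivlMr ?ltr0n// mulrC -lee_fin EFinM !Pr_EFin//.
rewrite (sym (fun x y => h x = h y))// -esumZl; [|by []|]; last first.
  by move=> x; apply: esum_ge0 => y _; rewrite lee_fin.
have -> : ~` [set xy : T * T | xy.1 = xy.2] = [set xy | xy.1 <> xy.2 /\ True].
  by apply/seteqP; split=> xy //= [].
rewrite (sym (fun _ _ => True))//; apply: le_esum => x _.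
apply: le_trans (hP x) _; apply: subset_esum => // y _; by rewrite lee_fin.
Qed.

(** * Finite sources *)

Lemma esum_fin (R : realType) (I : finType) (A : set I) (f : I -> R) :
  (forall i, 0 <= f i) ->
  (\esum_(i in A) (f i)%:E)%E = (\sum_i (i \in A)%:R * f i)%:E.
Proof.
move=> f0; rewrite esum_mkcond.
rewrite (_ : [set: I] = [set` enum I]); last first.
  by apply/seteqP; split=> i //=; rewrite mem_enum.
rewrite esum_seq ?enum_uniq//; last by move=> i; case: ifP => // _; rewrite lee_fin.
rewrite big_enum /= -sumEFin; apply: eq_bigr => i _.
by case: ifP => _; rewrite ?mul1r ?mul0r.
Qed.

(** Local randomness must be independent of the source, while Alice's choice has a law depending on
    her symbol. So one answer is drawn in advance for every input, independently, and only the
    answer for the actual input is read. *)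
Lemma finite_kernel (R : realType) (I J : finType) (law : I -> J -> R) :
  (forall i j, 0 <= law i j) -> (forall i, \sum_j law i j = 1) ->
  exists2 PA : {ffun I -> J} -> R, is_pmf PA &
  forall i (F : J -> R), \sum_g PA g * F (g i) = \sum_j law i j * F j.
Proof.
move=> law0 law1; pose PA (g : {ffun I -> J}) := \prod_i law i (g i).
have PA0 g : 0 <= PA g by apply: prodr_ge0.
exists PA.
  split=> //; rewrite esum_fin//; congr (_%:E).
  under eq_bigr do rewrite mem_set// mul1r.
  rewrite -(bigA_distr_bigA law) big1// => i _.
move=> i F.
transitivity (\sum_(g : {ffun I -> J}) \prod_k (law k (g k) * (if k == i then F (g k)
  else 1))).
  apply: eq_bigr => g _; rewrite big_split /=; congr (_ * _).
  by rewrite (bigD1 i)//= eqxx big1 ?mulr1// => k /negbTE ->.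
rewrite -(bigA_distr_bigA (fun k j => law k j * (if k == i then F j else 1))) /=.
rewrite (bigD1 i)//= eqxx [X in _ * X]big1 ?mulr1// => k /negbTE ->.
by under eq_bigr do rewrite mulr1.
Qed.

(** The log-sum inequality: a bin index has entropy at most [log m]. This is where the [log m] of
    the bound is spent. *)
Lemma log_sum_le (R : realType) (m : nat) (sig : 'I_m -> R) :
  (0 < m)%N -> (forall b, 0 <= sig b) -> 0 < \sum_b sig b ->
  (\sum_b sig b) * log2 ((\sum_b sig b) / m%:R) <= \sum_b sig b * log2 (sig b).
Proof.
move=> m0 sig0; set S := \sum_b sig b => S0.
have m0' : 0 < m%:R :> R by rewrite ltr0n.
have l2 : 0 < ln (2 : R) by rewrite ln_gt0 ?ltr1n.
rewrite {1}/S mulr_suml -subr_ge0 -sumrB.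
apply: (@le_trans _ _ (\sum_b (sig b - S / m%:R) / ln 2)).
  rewrite -mulr_suml sumrB sumr_const card_ord -/S -[_ *+ m]mulr_natr divfK ?gt_eqF//.
  by rewrite subrr mul0r.
apply: ler_sum => b _; rewrite /log2 !mulrA -mulrBl ler_pM2r ?invr_gt0//.
have [->|bn0] := eqVneq (sig b) 0.
  by rewrite !mul0r subrr sub0r oppr_le0 divr_ge0// ltW.
have b0 : 0 < sig b by rewrite lt_neqAle eq_sym bn0 sig0.
rewrite -mulrBr; set t := S / m%:R; have t0 : 0 < t by rewrite divr_gt0.
have -> : sig b - t = - (sig b * (t / sig b - 1)) by field.
have -> : ln (sig b) - ln t = - ln (t / sig b) by rewrite ln_div ?posrE// opprB.
rewrite mulrN lerN2 ler_pM2l//.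
have tb : 0 < t / sig b by rewrite divr_gt0.
by have := @le_ln1Dx R (t / sig b - 1); rewrite [1 + _]addrC subrK; apply; lra.
Qed.

Lemma binned_mixture (R : realType) (T : choiceType) (m : nat) (h : T -> 'I_m)
    (s : seq T) (D : T -> R) :
  (0 < m)%N -> s != [::] -> uniq s -> {in s, forall x, 0 < D x} ->
  exists L : seq (R * seq (T * seq bool)),
  [/\ {in L, forall p, [/\ 0 <= p.1, code_on R s p.2 &
         {in unzip1 p.2 &, forall x y, h x = h y}]},
      {in s, forall x, code_sum L (fun k => 2^-1 ^+ size k) x = D x} &
      (\sum_(x <- s) D x) * log2 ((\sum_(x <- s) D x) / m%:R)
       - \sum_(x <- s) D x * log2 (D x) - \sum_(x <- s) D x
      <= \sum_(x <- s) code_sum L (fun k => 2^-1 ^+ size k * (size k)%:R) x].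
Proof.
move=> m0 s0 us D0; pose sb b := [seq x <- s | h x == b].
have exL b : exists L : seq (R * seq (T * seq bool)),
  [/\ {in L, forall p, 0 <= p.1 /\ code_on R (sb b) p.2},
      {in sb b, forall x, code_sum L (fun k => 2^-1 ^+ size k) x = D x} &
      (\sum_(x <- sb b) D x) * log2 (\sum_(x <- sb b) D x)
       - \sum_(x <- sb b) D x * log2 (D x) - \sum_(x <- sb b) D x
      <= \sum_(x <- sb b) code_sum L (fun k => 2^-1 ^+ size k * (size k)%:R) x].
  have [e|n0] := eqVneq (sb b) [::].
    exists [::]; split; rewrite ?e//.
    by rewrite !big_nil mul0r !subr0.
  have D0' : {in sb b, forall x, 0 < D x}.
    by move=> x; rewrite mem_filter => /andP[_ /D0].
  have [L [cL mL lL]] := huffman_mixture n0 (filter_uniq _ us) D0'.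
  (* With [lam := 0] a bin loses at most its own mass, so over all bins the loss is still one bit
     times the total mass. *)
  exists L; split=> //; have := lL 0; rewrite subr0; apply.
  by move=> x /D0' /ltW.
pose Lf b := projT1 (cid (exL b)).
have cL b := let: And3 h1 _ _ := projT2 (cid (exL b)) in h1.
have mL b := let: And3 _ h1 _ := projT2 (cid (exL b)) in h1.
have lL b := let: And3 _ _ h1 := projT2 (cid (exL b)) in h1.
rewrite -/(Lf _) in cL mL lL.
pose L := flatten [seq Lf b | b <- enum 'I_m].
have sumL f x : code_sum L f x = code_sum (Lf (h x)) f x.
  rewrite /code_sum big_flatten big_map big_enum /= (bigD1 (h x))//= [X in _ + X]big1
    ?addr0//.
  move=> b bx; rewrite big_seq_cond big1// => p /andP[pL xp].
  have [_ [_ /(_ _ xp) + _]] := cL _ _ pL.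
  by rewrite mem_filter => /andP[/eqP e]; rewrite e eqxx in bx.
have sums (F : T -> R) : \sum_(x <- s) F x = \sum_b \sum_(x <- sb b) F x.
  rewrite (partition_big h xpredT)//=; apply: eq_bigr => b _.
  by rewrite big_filter.
exists L; split.
- move=> p /flattenP[_ /mapP[b _ ->] pL].
  have [p0 [u1 u2 u3]] := cL _ _ pL; split=> //.
    by split=> // x /u2; rewrite mem_filter => /andP[].
  by move=> x y /u2 + /u2; rewrite !mem_filter => /andP[/eqP -> _] /andP[/eqP -> _].
- by move=> x xs; rewrite sumL mL// mem_filter eqxx.
- under [leRHS]eq_bigr do rewrite sumL.
  rewrite !sums.
  have sig0 b : 0 <= \sum_(x <- sb b) D x.
    by rewrite big_seq sumr_ge0// => x; rewrite mem_filter => /andP[_ /D0 /ltW].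
  have S0 : 0 < \sum_b \sum_(x <- sb b) D x.
    rewrite -sums; case: s s0 D0 {us sb exL Lf cL mL lL L sumL sums sig0} => // x s _ D0.
    rewrite big_cons ltr_pwDl ?D0 ?inE ?eqxx// big_seq sumr_ge0// => y ys.
    by rewrite ltW// D0// inE ys orbT.
  apply: (@le_trans _ _ (\sum_b ((\sum_(x <- sb b) D x) * log2 (\sum_(x <- sb b) D x)
       - \sum_(x <- sb b) D x * log2 (D x) - \sum_(x <- sb b) D x))).
    by rewrite !sumrB !lerD2r log_sum_le.
  apply: ler_sum => b _; apply: le_trans (lL b) _.
  rewrite le_eqVlt; apply/orP; left; apply/eqP.
  by apply: eq_big_seq => x; rewrite mem_filter => /andP[/eqP ->].
Qed.

(** Alice's half of a scheme. The empty code is the message by which she declines, and [C] may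
    depend on [w] but not on [x], which says that [X] given [w] and [X = Y] is dyadic. The type [GA]
    is existential since the two constructions use different randomness. *)
Definition code_scheme (R : realType) (T : choiceType) (PXY : T * T -> R)
    (m : nat) (h : T -> 'I_m) (ell : \bar R) : Prop :=
  exists (GA : choiceType) (PA : GA -> R) (w1 : T -> GA -> seq (T * seq bool)),
  [/\ is_pmf PA,
    forall x g, w1 x g != [::] ->
      [/\ x \in unzip1 (w1 x g), uniq (unzip1 (w1 x g)) & full R (unzip2 (w1 x g))],
    forall w, exists C, forall x, x \in unzip1 w ->
      PXY (x, x) * Pr PA [set g | w1 x g = w] = C * 2^-1 ^+ size (word w x),
    forall x y g, y \in unzip1 (w1 x g) -> h x = h y &
    (ell <= \esum_(xg in [set: T * GA])
      (PXY (xg.1, xg.1) * PA xg.2 * (size (word (w1 xg.1 xg.2) xg.1))%:R)%:E)%E].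

Lemma huffman_scheme (R : realType) (T : choiceType) (PXY : T * T -> R)
    (m : nat) (h : T -> 'I_m) (s : seq T) :
  is_pmf PXY -> (0 < m)%N -> s != [::] -> uniq s ->
  {in s, forall x, 0 < PXY (x, x)} ->
  code_scheme PXY h
    ((\sum_(x <- s) PXY (x, x)) * log2 ((\sum_(x <- s) PXY (x, x)) / m%:R)
     - \sum_(x <- s) PXY (x, x) * log2 (PXY (x, x)) - \sum_(x <- s) PXY (x, x))%:E.
Proof.
move=> [P0 _] m0 s0 us D0; pose D x := PXY (x, x).
have [L [cL mL lL]] := binned_mixture h m0 s0 us D0.
pose J := 'I_(size L); pose I := seq_sub s.
pose Lj (j : J) : R * seq (T * seq bool) := nth (0, [::]) L j.
have LjL j : Lj j \in L by exact: mem_nth.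
have sumJ f x : code_sum L f x = \sum_(j : J)
  (x \in unzip1 (Lj j).2)%:R * ((Lj j).1 * f (word (Lj j).2 x)).
  rewrite /code_sum (big_nth (0, [::])) big_mkord big_mkcond /=.
  by apply: eq_bigr => j _; rewrite -/(Lj j); case: ifP; rewrite (mul1r, mul0r).
(* By Bayes' rule, drawing code [j] with this probability makes the joint mass of [X = Y = x] and
   [j] equal to its weight times [2^-|w(x)|]. The mass identity of the mixture says that these
   probabilities sum to 1. *)
pose law (i : I) (j : J) : R :=
  (ssval i \in unzip1 (Lj j).2)%:R * ((Lj j).1 * 2^-1 ^+ size (word (Lj j).2 (ssval
    i))) / D (ssval i).
have law0 i j : 0 <= law i j.
  have [p0 _ _] := cL _ (LjL j).
  by rewrite divr_ge0// ?P0// mulr_ge0// mulr_ge0// exprn_ge0.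
have law1 i : \sum_j law i j = 1.
  rewrite -mulr_suml -(sumJ (fun k => 2^-1 ^+ size k)) mL ?(valP i)//.
  by rewrite divff// gt_eqF// D0 ?(valP i).
have [PA PA1 marg] := finite_kernel law0 law1; have [PA0 _] := PA1.
(* A code without [x] has probability zero under [law], but the conditions on messages concern every
   [g], so such draws are sent as the empty code. *)
pose w1 x (g : {ffun I -> J}) : seq (T * seq bool) :=
  if (insub x : option I) is Some i then
    if x \in unzip1 (Lj (g i)).2 then (Lj (g i)).2 else [::] else [::].
exists {ffun I -> J}, PA, w1; split=> //.
- move=> x g; rewrite /w1; case: insubP => // i _ _.
  case: ifPn => // xw _; have [_ [u1 _ u3] _] := cL _ (LjL (g i)).
  by split.
(* The same code may occur several times in [L], and the message does not reveal which copy was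
   drawn, so the weights of all copies are added. *)
- move=> w; exists (\sum_(p <- L | p.2 == w) p.1) => x xw.
  rewrite /Pr esum_fin//= /w1; case: insubP => [i xs ix|xs].
    have -> : \sum_(g : {ffun I -> J}) (g \in [set g0 : {ffun I -> J} |
        (if x \in unzip1 (Lj (g0 i)).2 then (Lj (g0 i)).2 else [::]) = w])%:R * PA g =
      \sum_(g : {ffun I -> J}) PA g * ((Lj (g i)).2 == w)%:R.
      apply: eq_bigr => g _; rewrite mulrC; congr (_ * _%:R); congr nat_of_bool.
      apply/idP/eqP => [/set_mem /=|e]; last by apply/mem_set => /=; rewrite e xw.
      by case: ifP => // _ wn; rewrite -wn in xw.
    rewrite (marg i (fun j => ((Lj j).2 == w)%:R)) mulr_sumr mulr_suml.
    rewrite (big_nth (0, [::])) big_mkord [RHS]big_mkcond /=; apply: eq_bigr => j _.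
    rewrite -/(Lj j) /law /= -[ssval i]/(val i) ix.
    case: eqP => [->|_]; last by rewrite !mulr0.
    have : PXY (x, x) != 0 by rewrite gt_eqF// D0.
    by rewrite xw /D [true%:R]mulr1n => ?; field.
  rewrite big1; last first.
    by move=> g _; rewrite memNset ?mul0r//= => e; rewrite -e in xw.
  rewrite mulr0 big_seq_cond big1 ?mul0r// => p /andP[pL /eqP pw].
  have [_ [_ /(_ x) + _] _] := cL _ pL.
  by rewrite pw xw => /(_ isT); rewrite (negbTE xs).
- move=> x y g; rewrite /w1; case: insubP => // i _ _; case: ifPn => // xw yw.
  by have [_ _ hxy] := cL _ (LjL (g i)); apply: hxy.
- apply: (@le_trans _ _ (\sum_(x <- s) code_sum L (fun k =>
  2^-1 ^+ size k * (size k)%:R) x)%:E).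
    by rewrite lee_fin.
  have F0 (xg : T * {ffun I -> J}) : (0 <=
     (PXY (xg.1, xg.1) * PA xg.2 * (size (word (w1 xg.1 xg.2) xg.1))%:R)%:E)%E.
    by rewrite lee_fin mulr_ge0// mulr_ge0.
  apply: le_trans (subset_esum (A := [set` s] `*`` (fun=> setT)) _ _) => //.
  rewrite (eq_esum (b := fun xg => (PXY (xg.1, xg.1) *
     (PA xg.2 * (size (word (w1 xg.1 xg.2) xg.1))%:R))%:E)); last by move=> xg _;
       rewrite mulrA.
  rewrite (esum_prod _ _ (f := fun x => PXY (x, x))
     (g := fun x g => PA g * (size (word (w1 x g) x))%:R))//; last by move=> x g;
       rewrite mulr_ge0.
  rewrite esum_seq//; last first.
    by move=> x; rewrite mule_ge0// ?lee_fin// esum_ge0// => g _; rewrite lee_fin mulr_ge0.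
  rewrite -sumEFin le_eqVlt; apply/orP; left; apply/eqP; apply: eq_big_seq => x xs.
  rewrite esum_fin; last by move=> g; rewrite mulr_ge0.
  rewrite -EFinM; congr (_%:E).
  have xE : (insub x : option I) = Some (SeqSub xs) by rewrite insubT.
  rewrite (_ : \sum_(g : {ffun I -> J}) _ = \sum_(g : {ffun I -> J}) PA g *
     ((x \in unzip1 (Lj (g (SeqSub xs))).2)%:R * (size (word (Lj (g (SeqSub xs))).2
       x))%:R)); last first.
    apply: eq_bigr => g _; rewrite mem_set// mul1r; congr (_ * _).
    by rewrite /w1 xE; case: ifP => _; rewrite (mul1r, mul0r).
  rewrite (marg (SeqSub xs) (fun j =>
    (x \in unzip1 (Lj j).2)%:R * (size (word (Lj j).2 x))%:R)).
  rewrite mulr_sumr sumJ; apply: eq_bigr => j _; rewrite /law /=.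
  have : PXY (x, x) != 0 by rewrite gt_eqF// D0.
  by case: (x \in _) => ?; rewrite ?[true%:R]mulr1n ?[false%:R]mulr0n /D; field.
Qed.

(** * Sources of infinite entropy *)

Lemma esum_nat_le (R : realType) (u : nat -> R) (a : R) :
  (forall i, 0 <= u i) -> (forall n, \sum_(0 <= i < n) u i <= a) ->
  (\esum_(i in [set: nat]) (u i)%:E <= a%:E)%E.
Proof.
move=> u0 ua; rewrite -nneseries_esumT; last by move=> n; rewrite lee_fin.
apply: lime_le; first by apply: is_cvg_nneseries => n _ _; rewrite lee_fin.
by apply: nearW => n; rewrite sumEFin lee_fin.
Qed.

Lemma esum_dyadic (R : realType) (u : nat -> R) (a : R) :
  (forall i, 0 <= u i) ->
  (forall n, \sum_(0 <= i < n) u i <= a <= \sum_(0 <= i < n) u i + 2^-1 ^+ n) ->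
  (\esum_(i in [set: nat]) (u i)%:E = a%:E)%E.
Proof.
move=> u0 ua; apply/eqP; rewrite eq_le esum_nat_le//=; last by move=> n; case/andP: (ua n).
apply/lee_addgt0Pr => eps eps0; have [n] := ltr_add_invr eps0; rewrite add0r => neps.
case/andP: (ua n) => _ an; apply: (@le_trans _ _ (\sum_(0 <= i < n) u i + 2^-1 ^+ n)%:E).
  by rewrite lee_fin.
rewrite EFinD leeD//.
  rewrite -nneseries_esumT; last by move=> i; rewrite lee_fin.
  rewrite -sumEFin; apply: nneseries_lim_ge => i _ _; by rewrite lee_fin.
rewrite lee_fin (le_trans _ (ltW neps))// exprVn lef_pV2 ?posrE ?ltr0n ?exprn_gt0//.
by rewrite -natrX ler_nat ltn_expl.
Qed.

Lemma geometric_law_is_pmf (R : realType) : is_pmf (fun i : nat => 2^-1 ^+ i.+1 : R).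
Proof.
split=> [i|]; first by rewrite exprn_ge0.
apply: esum_dyadic => [i|n]; first by rewrite exprn_ge0.
suff -> : \sum_(0 <= i < n) (2^-1 ^+ i.+1 : R) = 1 - 2^-1 ^+ n.
  by rewrite subrK lexx andbT lerBlDr lerDl exprn_ge0.
elim: n => [|n IH]; first by rewrite big_nil subrr.
by rewrite big_nat_recr//= IH exprS; set t := _ ^+ _; lra.
Qed.

(* Binary expansion: a single geometric variable simulates a coin of any bias. *)
Lemma geometric_law_surjective (R : realType) (a : R) : 0 <= a <= 1 ->
  exists E : set nat, Pr (fun i : nat => 2^-1 ^+ i.+1) E = a.
Proof.
move=> /andP[a0 a1].
pose s := fix s n : R := if n is n'.+1 then
  s n' + (if s n' + 2^-1 ^+ n'.+1 <= a then 2^-1 ^+ n'.+1 else 0) else 0.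
pose E := [set i : nat | s i + 2^-1 ^+ i.+1 <= a].
exists E; rewrite /Pr esum_mkcond.
rewrite (eq_esum (b := fun i => (if i \in E then 2^-1 ^+ i.+1 else 0 : R)%:E)); last first.
  by move=> i _; case: ifP.
rewrite (@esum_dyadic _ _ a)//.
  by move=> i; case: ifP => // _; rewrite exprn_ge0.
move=> n.
have -> : \sum_(0 <= i < n) (if i \in E then 2^-1 ^+ i.+1 else 0 : R) = s n.
  elim: n => [|n IH]; first by rewrite big_nil.
  rewrite big_nat_recr//= IH; congr (_ + _); case: ifPn => [/set_mem ->//|].
  by move=> /negP nE; rewrite ifN//; apply/negP => h; apply: nE; apply/mem_set.
elim: n => [|n /andP[IH1 IH2]]; first by rewrite /= expr0 add0r a0 a1.
have e : 2^-1 ^+ n = 2^-1 ^+ n.+1 + 2^-1 ^+ n.+1 :> R by rewrite exprS; set t :=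
  _ ^+ _; lra.
rewrite [s n.+1]/=; case: ifPn => [h|]; first by rewrite h /= -addrA -e.
by rewrite -ltNge addr0 IH1 /= => /ltW.
Qed.

Fixpoint bitstrings (n : nat) : seq (seq bool) :=
  if n is n'.+1 then
    map (cons false) (bitstrings n') ++ map (cons true) (bitstrings n')
  else [:: [::]].

Lemma size_bitstrings n : size (bitstrings n) = (2 ^ n)%N.
Proof. by elim: n => //= n IH; rewrite size_cat !size_map IH expnS mul2n addnn. Qed.

Lemma mem_bitstrings n k : k \in bitstrings n -> size k = n.
Proof.
elim: n k => [|n IH] k /=; first by rewrite inE => /eqP ->.
by rewrite mem_cat => /orP[] /mapP[k' /IH <- ->].
Qed.

Lemma full_bitstrings (R : realType) n : full R (bitstrings n).
Proof. by elim: n => [|n IH] /=; [exact: full_nil|exact: full_join]. Qed.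

Lemma sum_linear_geometric_le2 (R : realType) n :
  \sum_(0 <= i < n) (i%:R * 2^-1 ^+ i : R) <= 2.
Proof.
suff -> : \sum_(0 <= i < n) (i%:R * 2^-1 ^+ i : R) = 2 - (n%:R + 1) * 2 * 2^-1 ^+ n.
  by rewrite lerBlDr lerDl !mulr_ge0// ?exprn_ge0// addr_ge0.
elim: n => [|n IH]; first by rewrite big_nil expr0; lra.
by rewrite big_nat_recr//= IH exprS -natr1; set t := _ ^+ _; field.
Qed.

Lemma pmf_le1 (R : realType) (T : choiceType) (f : T -> R) (t : T) :
  is_pmf f -> f t <= 1.
Proof.
move=> fP; have [f0 _] := fP.
by have := esum_le1 [set t] fP; rewrite esum_set1 lee_fin.
Qed.

Lemma neg_xlog2_ge0 (R : realType) (x : R) : 0 <= x <= 1 -> 0 <= - (x * log2 x).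
Proof.
move=> /andP[x0 x1]; rewrite oppr_ge0 mulr_ge0_le0// /log2.
by rewrite mulr_le0_ge0 ?ln_le0// invr_ge0 ln_ge0// ler1n.
Qed.

(** The ratio 4 leaves room for a summable error: a class of level [k] with at most [2^k] symbols
    has entropy contribution of order [k * 2^-k]. *)
Definition level_class (R : realType) (T : choiceType) (D : T -> R) (m : nat)
    (h : T -> 'I_m) (kb : nat * 'I_m) : set T :=
  [set x | 4^-1 ^+ kb.1 <= D x < 4 * 4^-1 ^+ kb.1 /\ h x = kb.2].

Lemma level_class_inj (R : realType) (T : choiceType) (D : T -> R) (m : nat)
    (h : T -> 'I_m) (kb kb' : nat * 'I_m) (x : T) :
  level_class D h kb x -> level_class D h kb' x -> kb = kb'.
Proof.
have le (k k' : nat) : 4^-1 ^+ k <= D x < 4 * 4^-1 ^+ k ->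
    4^-1 ^+ k' <= D x < 4 * 4^-1 ^+ k' -> (k' <= k)%N.
  move=> /andP[h1 _] /andP[_ h2]; rewrite leqNgt; apply/negP => kk'.
  have : 4^-1 ^+ k' <= 4^-1 ^+ k.+1 :> R.
    by apply: ler_wiXn2l; rewrite ?invr_ge0// invf_le1// ler1n.
  by rewrite exprS; lra.
case: kb kb' => [k b] [k' b'] [/= h1 <-] [/= h2 <-]; congr (_, _).
by apply/eqP; rewrite eqn_leq (le _ _ h1 h2) (le _ _ h2 h1).
Qed.

Lemma level_class_total (R : realType) (T : choiceType) (D : T -> R) (m : nat)
    (h : T -> 'I_m) (x : T) :
  0 < D x <= 1 -> exists kb, level_class D h kb x.
Proof.
move=> /andP[D0 D1].
have [|k kD kmin] := @ex_minnP (fun k => 4^-1 ^+ k <= D x).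
  have [n] := ltr_add_invr D0; rewrite add0r => nD; exists n.
  apply: le_trans (ltW nD); rewrite exprVn lef_pV2 ?posrE ?ltr0n ?exprn_gt0//.
  by rewrite -natrX ler_nat ltn_expl.
exists (k, h x); split=> //=; rewrite kD /=.
case: k kD kmin => [|k] kD kmin; first by rewrite expr0; lra.
have : ~~ (4^-1 ^+ k <= D x) by apply/negP => /kmin; rewrite ltnn.
by rewrite -ltNge exprS mulrA divff ?mul1r.
Qed.

Lemma finite_level_class (R : realType) (T : choiceType) (PXY : T * T -> R)
    (m : nat) (h : T -> 'I_m) (kb : nat * 'I_m) :
  is_pmf PXY -> finite_set (level_class (fun x => PXY (x, x)) h kb).
Proof.
move=> PXY1.
have fin : finite_set ((fun x => (x, x)) @^-1` [set xy | 4^-1 ^+ kb.1 <= PXY xy]).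
  apply: finite_preimage; first by move=> x y _ _ [].
  by apply: finite_superlevel => //; rewrite exprn_gt0// invr_gt0.
by apply: sub_finite_set fin => x [/andP[]].
Qed.

Lemma esum_level_classes (R : realType) (T : choiceType) (D : T -> R) (m : nat)
    (h : T -> 'I_m) (S : nat * 'I_m -> set T) (f : T -> \bar R) :
  (forall kb, S kb `<=` level_class D h kb) -> (forall x, 0 <= f x)%E ->
  (\esum_(kb in [set: nat * 'I_m]) \esum_(x in S kb) f x =
   \esum_(x in \bigcup_kb S kb) f x)%E.
Proof.
move=> SC f0; rewrite esum_esum//.
have -> : \bigcup_kb S kb = snd @` ([set: nat * 'I_m] `*`` S).
  apply/seteqP; split=> [x [kb _ Sx]|_ [[kb x] [_ Sx] <-]]; last by exists kb.
  by exists (kb, x).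
rewrite esum_image// => -[kb x] [kb' x'] /set_mem[_ /= Sx] /set_mem[_ /= Sx'] /= e.
by rewrite -e in Sx' *; rewrite (level_class_inj (SC _ _ Sx) (SC _ _ Sx')).
Qed.

(** For a class of [N] symbols at level [k], the left side bounds the entropy and the first term on
    the right is 16 times the key length obtained from [c] words of length [n]. It suffices if
    [k <= n]; otherwise the class has at most [2^k] symbols and the summable second term takes
    over. *)
Lemma class_entropy_le (R : realType) (N n k c : nat) :
  (c = if N == 0 then 0 else 2 ^ n)%N -> (N <= 2 * 2 ^ n)%N ->
  N%:R * (4 * 4^-1 ^+ k * (2 * k%:R)) <=
  16 * (c%:R * (4^-1 ^+ k * n%:R)) + 16 * (k%:R * 2^-1 ^+ k) :> R.
Proof.
move=> cE NM; have q0 : 0 <= 4^-1 ^+ k :> R by rewrite exprn_ge0.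
have h0 : 0 <= 2^-1 ^+ k :> R by rewrite exprn_ge0.
have [N0|N0] := eqVneq N 0%N.
  by rewrite N0 mul0r addr_ge0// !mulr_ge0.
rewrite cE (negbTE N0).
have {}NM : N%:R <= 2 * (2 ^ n)%:R :> R by rewrite -natrM ler_nat.
apply: (@le_trans _ _ (2 * (2 ^ n)%:R * (4 * 4^-1 ^+ k * (2 * k%:R)))).
  by rewrite ler_wpM2r// !mulr_ge0.
have -> : 2 * (2 ^ n)%:R * (4 * 4^-1 ^+ k * (2 * k%:R)) =
    16 * ((2 ^ n)%:R * 4^-1 ^+ k * k%:R) :> R by ring.
have [kn|nk] := leqP k n.
  apply: ler_wpDr; first by rewrite !mulr_ge0.
  by rewrite ler_pM2l// -mulrA ler_wpM2l// ler_wpM2l// ler_nat.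
apply: ler_wpDl; first by rewrite !mulr_ge0.
rewrite ler_pM2l// [leRHS]mulrC ler_wpM2r//.
have -> : 4^-1 = 2^-1 * 2^-1 :> R by field.
rewrite exprMn mulrA ler_piMl// exprVn ler_pdivrMr ?exprn_gt0// mul1r natrX.
by rewrite ler_weXn2l ?ler1n// ltnW.
Qed.

(* With infinite entropy, constant-factor losses are harmless: keep [2 ^ n]
   symbols of each class of comparable probabilities and thin them out to equal
   probabilities. *)
Lemma uniform_scheme (R : realType) (T : choiceType) (PXY : T * T -> R)
    (m : nat) (h : T -> 'I_m) :
  is_pmf PXY ->
  (\esum_(x in [set: T]) (- (PXY (x, x) * log2 (PXY (x, x))))%:E = +oo)%E ->
  code_scheme PXY h +oo%E.
Proof.
move=> PXY1 entoo; have [P0 _] := PXY1; pose D x := PXY (x, x).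
pose Cl := level_class D h.
have finCl kb : finite_set (Cl kb) by exact: finite_level_class.
pose lst kb : seq T := fset_set (Cl kb).
have lstE kb x : x \in lst kb = (x \in Cl kb) by rewrite in_fset_set.
pose n kb := trunc_log 2 (size (lst kb)).
pose sel kb := take (2 ^ n kb) (lst kb).
pose code kb := zip (sel kb) (bitstrings (n kb)).
have sel_size kb : size (sel kb) = if size (lst kb) == 0%N then 0%N else (2 ^ n kb)%N.
  rewrite size_take_min; case: eqVneq => [->|N0]; first by rewrite minn0.
  by apply/minn_idPl; rewrite trunc_logP// lt0n.
have sel_le kb : (size (sel kb) <= size (bitstrings (n kb)))%N.
  by rewrite size_bitstrings sel_size; case: ifP.
have key1 kb : unzip1 (code kb) = sel kb by rewrite unzip1_zip.
have key2 kb x : x \in sel kb -> unzip2 (code kb) = bitstrings (n kb).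
  move=> xs; rewrite unzip2_zip// size_bitstrings sel_size; case: ifPn => // /eqP.
  by move=> /size0nil e; rewrite /sel e in xs.
have selCl kb x : x \in sel kb -> Cl kb x by move=> /mem_take; rewrite lstE => /set_mem.
have word_size kb x : x \in sel kb -> size (word (code kb) x) = n kb.
  move=> xs; apply: mem_bitstrings; rewrite /word (key2 _ _ xs) mem_nth//.
  rewrite key1; apply: (leq_trans _ (sel_le kb)); by rewrite index_mem.
pose cls x := xget (0%N, h x) [set kb | Cl kb x].
have clsE kb x : Cl kb x -> cls x = kb.
  move=> Cx; have Cx' : Cl (cls x) x by apply: (@xgetPex _ (0%N, h x) [set kb | Cl kb
    x]); exists kb.
  exact: level_class_inj Cx' Cx.
pose PA i : R := 2^-1 ^+ i.+1.
have PA1 : is_pmf PA := geometric_law_is_pmf R.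
have PA0 i : 0 <= PA i by case: PA1.
(* Alice sends her code only on this event, so each selected symbol of level [k] keeps the joint
   mass [4^-k], the lower end of its class. *)
have exE x : exists E : set nat, forall kb, Cl kb x -> Pr PA E = 4^-1 ^+ kb.1 / D x.
  have [[kb Cx]|nC] := pselect (exists kb, Cl kb x); last first.
    by exists set0 => kb Cx; case: nC; exists kb.
  have [/andP[c1 _] _] := Cx.
  have D0 : 0 < D x by apply: lt_le_trans c1; rewrite exprn_gt0// invr_gt0.
  have [|E EP] := @geometric_law_surjective R (4^-1 ^+ kb.1 / D x).
    apply/andP; split; last by rewrite ler_pdivrMr// mul1r.
    by apply: divr_ge0; [rewrite exprn_ge0|exact: ltW].
  by exists E => kb' Cx'; rewrite EP (level_class_inj Cx' Cx).
pose Ex x := projT1 (cid (exE x)).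
have ExP x kb : Cl kb x -> Pr PA (Ex x) = 4^-1 ^+ kb.1 / D x := projT2 (cid (exE x)) kb.
pose w1 x (g : nat) := if (x \in sel (cls x)) && (g \in Ex x) then code (cls x) else [::].
have w1E kb x g : x \in sel kb -> w1 x g = if g \in Ex x then code kb else [::].
  by move=> xs; rewrite /w1 (clsE _ _ (selCl _ _ xs)) xs.
have D0 kb x : x \in sel kb -> D x != 0.
  move=> /selCl[/andP[c1 _] _]; rewrite gt_eqF//; apply: lt_le_trans c1.
  by rewrite exprn_gt0// invr_gt0.
have lsel_uniq kb : uniq (sel kb) by rewrite take_uniq// fset_uniq.
exists nat, PA, w1; split=> //.
- move=> x g; rewrite /w1; case: ifP => // /andP[xs _] _.
  by rewrite key1 (key2 _ _ xs); split=> //; exact: full_bitstrings.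
- move=> w; have [[kb wE]|nw] := pselect (exists kb, code kb = w); last first.
    exists 0 => x xw; rewrite (_ : [set g | _] = set0) /Pr ?esum_set0 ?mulr0 ?mul0r//.
    apply/seteqP; split=> // g /=; rewrite /w1; case: ifP => _ e.
      by apply: nw; exists (cls x).
    by rewrite -e in xw.
  exists ((2 ^ n kb)%:R * 4^-1 ^+ kb.1) => x; rewrite -wE key1 => xs.
  have -> : [set g | w1 x g = code kb] = Ex x.
    apply/seteqP; split=> g /=; rewrite (w1E _ _ _ xs); last by move=> gE; rewrite mem_set.
    case: ifPn => [/set_mem//|_ e]; move: xs; by rewrite -key1 -e.
  rewrite (ExP _ _ (selCl _ _ xs)) word_size// -/(D x).
  rewrite mulrCA divff ?(D0 kb)// mulr1 natrX mulrAC -exprMn divff//.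
  by rewrite expr1n mul1r.
- move=> x y g; rewrite /w1; case: ifP => // /andP[xs _]; rewrite key1 => ys.
  by have [_ ->] := selCl _ _ xs; have [_ ->] := selCl _ _ ys.
(* By contradiction: class by class, the entropy is at most 16 times the key length plus a term
   whose sum over the levels and the [m] bins converges, so a finite length would force a finite
   entropy. *)
rewrite leye_eq; apply/negP => /negP; rewrite -ltey => Lfin.
pose len x : \bar R := ((D x)%:E * \esum_(g in [set: nat])
  (PA g * (size (word (w1 x g) x))%:R)%:E)%E.
have len0 x : (0 <= len x)%E.
  by rewrite mule_ge0 ?lee_fin ?P0// esum_ge0// => g _; rewrite lee_fin mulr_ge0.
have LE : (\esum_(xg in [set: T * nat])
    (PXY (xg.1, xg.1) * PA xg.2 * (size (word (w1 xg.1 xg.2) xg.1))%:R)%:E =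
    \esum_(x in [set: T]) len x)%E.
  rewrite -(esum_prod setT (fun=> setT) (f := D) (g := fun x g =>
    PA g * (size (word (w1 x g) x))%:R)).
  - rewrite [X in _ = esum X _](_ : _ = setT); last by apply/seteqP; split.
    by apply: eq_esum => xg _; rewrite mulrA.
  - by move=> x; exact: P0.
  - by move=> x g; rewrite mulr_ge0.
rewrite LE in Lfin.
have lenE kb x : x \in sel kb -> len x = (4^-1 ^+ kb.1 * (n kb)%:R)%:E.
  move=> xs; rewrite /len.
  have -> : (\esum_(g in [set: nat]) (PA g * (size (word (w1 x g) x))%:R)%:E =
      \esum_(g in Ex x) ((n kb)%:R%:E * (PA g)%:E))%E.
    rewrite [RHS]esum_mkcond; apply: eq_esum => g _; rewrite (w1E _ _ _ xs).
    by case: ifP => _; rewrite ?word_size// ?mulr0// -EFinM mulrC.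
  rewrite esumZl//.
  rewrite -Pr_EFin// (ExP _ _ (selCl _ _ xs)) -!EFinM; congr (_%:E).
  by have := D0 _ _ xs => ?; field.
pose lam kb : R := (size (sel kb))%:R * (4^-1 ^+ kb.1 * (n kb)%:R).
have lam0 kb : 0 <= lam kb by rewrite !mulr_ge0// exprn_ge0.
have Llam : (\esum_(kb in [set: nat * 'I_m]) (lam kb)%:E <= \esum_(x in [set: T]) len x)%E.
  apply: (@le_trans _ _ (\esum_(kb in [set: nat * 'I_m]) \esum_(x in [set` sel kb]) len
    x)%E).
    apply: le_esum => kb _;
      rewrite esum_seq// (eq_big_seq (fun=> (4^-1 ^+ kb.1 * (n kb)%:R)%:E)).
      by rewrite sumEFin big_const_seq count_predT iter_addr_0 /lam mulr_natl.
    by move=> x xs; rewrite (lenE kb).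
  rewrite (esum_level_classes (D := D) (h := h))//.
  exact: subset_esum.
have D1 x : D x <= 1 := pmf_le1 (x, x) PXY1.
pose ent x : \bar R := (- (D x * log2 (D x)))%:E.
have ent0 x : (0 <= ent x)%E by rewrite lee_fin neg_xlog2_ge0// D1 P0.
have entCl kb : (\esum_(x in Cl kb) ent x <=
    (16 * lam kb + 16 * (kb.1%:R * 2^-1 ^+ kb.1))%:E)%E.
  have -> : Cl kb = [set` lst kb].
    by apply/seteqP; split=> x /=; rewrite lstE; [move/mem_set|move/set_mem].
  rewrite esum_seq ?fset_uniq//.
  apply: (@le_trans _ _ (\sum_(x <- lst kb) (4 * 4^-1 ^+ kb.1 * (2 * kb.1%:R))%:E)%E).
    rewrite big_seq [leRHS]big_seq; apply: lee_sum => x; rewrite lstE =>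
      /set_mem[/andP[c1 c2] _].
    have q0 : 0 < 4^-1 ^+ kb.1 :> R by rewrite exprn_gt0// invr_gt0.
    have Dx0 : 0 < D x by lra.
    rewrite lee_fin -mulrN ler_pM//; [exact: ltW| |exact: ltW|].
      rewrite /log2 -mulNr divr_ge0//; last by rewrite ln_ge0// ler1n.
      by rewrite oppr_ge0 ln_le0.
    have l2 : 0 < ln (2 : R) by rewrite ln_gt0 ?ltr1n.
    rewrite /log2 -mulNr ler_pdivrMr// -lnV ?posrE//.
    have -> : 2 * kb.1%:R * ln 2 = ln ((4^-1 ^+ kb.1)^-1) :> R.
      have l4 : ln 4 = 2 * ln 2 :> R.
        have -> : 4 = 2 * 2 :> R by ring.
        by rewrite lnM ?posrE// mulr_natl mulr2n.
      by rewrite exprVn invrK lnXn// l4 -[RHS]mulr_natl; ring.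
    by rewrite ler_ln ?posrE ?invr_gt0// lef_pV2.
  rewrite sumEFin lee_fin big_const_seq count_predT iter_addr_0 -[leLHS]mulr_natl.
  apply: class_entropy_le (sel_size kb) _.
  have [->//|N0] := eqVneq (size (lst kb)) 0%N.
  by rewrite -expnS ltnW// trunc_log_ltn.
have : (\esum_(x in [set: T]) ent x < +oo)%E; last by rewrite [X in (X < _)%E]entoo.
have -> : (\esum_(x in [set: T]) ent x = \esum_(x in \bigcup_kb Cl kb) ent x)%E.
  rewrite (esumID (\bigcup_kb Cl kb))// setTI [X in (_ + X)%E]esum1 ?adde0// => x [_ nx].
  rewrite /ent; have := P0 (x, x); rewrite le_eqVlt => /predU1P[|Dx0].
    by rewrite /D => <-; rewrite mul0r oppr0.
  have [|kb Cx] := @level_class_total R T D m h x; first by rewrite Dx0 D1.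
  by case: nx; exists kb.
rewrite -(esum_level_classes (D := D) (h := h) (S := Cl))//; last by move=> kb x.
apply: le_lt_trans (le_esum (fun kb _ => entCl kb)) _.
rewrite (eq_esum (b := fun kb => (16%:E * (lam kb)%:E +
   16%:E * (kb.1%:R * 2^-1 ^+ kb.1)%:E)%E))//.
have kk0 k : 0 <= k%:R * 2^-1 ^+ k :> R by rewrite mulr_ge0// exprn_ge0.
rewrite esumD; [|by move=> kb _; rewrite -EFinM lee_fin mulr_ge0..].
rewrite !esumZl//; [|by move=> kb; rewrite lee_fin..].
apply: lte_add_pinfty.
  apply: lte_mul_pinfty; rewrite ?lee_fin//; exact: le_lt_trans Llam Lfin.
apply: lte_mul_pinfty; rewrite ?lee_fin//.
apply: (@le_lt_trans _ _ (m%:R%:E * 2%:E)%E); last by rewrite -EFinM ltry.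
rewrite (eq_esum (b := fun kb : nat * 'I_m => (kb.1%:R * 2^-1 ^+ kb.1 * 1)%:E)); last first.
  by move=> kb _; rewrite mulr1.
rewrite [X in esum X _](_ : _ = [set: nat] `*`` (fun=> [set: 'I_m])); last first.
  by apply/seteqP; split.
rewrite (esum_prod _ _ (f := fun k => k%:R * 2^-1 ^+ k) (g := fun _ _ => 1))//.
rewrite (eq_esum (b := fun k => (m%:R%:E * (k%:R * 2^-1 ^+ k)%:E)%E)); last first.
  move=> k _; rewrite esum_fin//; under eq_bigr do rewrite mem_set// mul1r.
  by rewrite sumr_const card_ord muleC.
rewrite esumZl//.
apply: lee_wpmul2l; first by rewrite lee_fin.
by apply: esum_nat_le => // k; exact: sum_linear_geometric_le2.
Qed.

(** * Conclusion *)

Lemma Pr_le (R : realType) (T : choiceType) (f : T -> R) (A B : set T) :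
  is_pmf f -> A `<=` B -> Pr f A <= Pr f B.
Proof.
move=> fP AB; have [f0 _] := fP.
by rewrite -lee_fin !Pr_EFin//; apply: subset_esum => // t _; rewrite lee_fin.
Qed.

Lemma is_pmf_unit (R : realType) : is_pmf (fun _ : unit => 1 : R).
Proof.
split=> [_|]; first exact: ler01.
rewrite esum_fin//; under eq_bigr do rewrite mem_set// mul1r.
by rewrite sumr_const card_unit.
Qed.

Lemma code_scheme_le (R : realType) (T : choiceType) (PXY : T * T -> R)
    (m : nat) (h : T -> 'I_m) (ell ell' : \bar R) :
  (ell <= ell')%E -> code_scheme PXY h ell' -> code_scheme PXY h ell.
Proof.
move=> le [GA [PA [w1 [h1 h2 h3 h4 h5]]]]; exists GA, PA, w1; split=> //.
exact: le_trans le h5.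
Qed.

Lemma trivial_scheme (R : realType) (T : choiceType) (PXY : T * T -> R)
    (m : nat) (h : T -> 'I_m) : (forall xy, 0 <= PXY xy) -> code_scheme PXY h 0%E.
Proof.
move=> P0; exists unit, (fun _ => 1), (fun _ _ => [::]); split=> //.
- exact: is_pmf_unit.
- move=> w; exists 0 => x xw; rewrite (_ : [set _ | _] = set0) /Pr.
    by rewrite esum_set0 mulr0 mul0r.
  by apply/seteqP; split=> // g /= e; rewrite -e in xw.
- by apply: esum_ge0 => xg _; rewrite mulr0.
Qed.

Lemma code_scheme_achieves (R : realType) (T : choiceType) (PXY : T * T -> R)
    (m : nat) (h : T -> 'I_m) (eps : R) (ell : \bar R) :
  is_pmf PXY -> Pr PXY [set xy | xy.1 <> xy.2 /\ h xy.1 = h xy.2] <= eps ->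
  code_scheme PXY h ell ->
  exists (GA GB W1T W2T : choiceType) (PA : GA -> R) (PB : GB -> R)
         (w1 : T -> GA -> W1T) (w2 : T -> GB -> W1T -> W2T)
         (kA : T -> GA -> W1T -> W2T -> seq bool)
         (kB : T -> GB -> W1T -> W2T -> seq bool),
    is_pmf PA /\ is_pmf PB /\ achieves2 PXY PA PB w1 w2 kA kB eps ell.
Proof.
move=> PXY1 hcoll [GA [PA [w1 [PA1 codew massw keyh len]]]].
exists GA, unit, (seq (T * seq bool) : choiceType), (bool : choiceType), PA, (fun=> 1), w1.
exists (fun y _ w => y \in unzip1 w), (fun x _ w b => if b then word w x else [::]),
  (fun y _ w b => if b then word w y else [::]).
split=> //; split; first exact: is_pmf_unit.
apply: codes_achieve => //; apply: le_trans hcoll; apply: Pr_le => // xy [xy12 [g yw]].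
by split=> //; exact: keyh yw.
Qed.

Lemma ln2_ge_half (R : realType) : 2^-1 <= ln 2 :> R.
Proof.
have := @le_ln1Dx R (- 2^-1).
have -> : 1 - 2^-1 = 2^-1 :> R by field.
by rewrite lnV ?posrE// lerN2; apply; lra.
Qed.

(** The cost of normalizing by the truncated mass [a] in place of [b]. It is [ln t <= t - 1] at
    [t = b / a]; the factor 2 bounds [1 / ln 2]. *)
Lemma xlog2_ratio_ge (R : realType) (a b : R) : 0 < a -> a <= b ->
  - (2 * (b - a)) <= a * (log2 a - log2 b).
Proof.
move=> a0 ab; have b0 : 0 < b by lra.
have l2 : 0 < ln (2 : R) by rewrite ln_gt0 ?ltr1n.
have : ln (b / a) <= b / a - 1.
  have t0 : 0 < b / a by rewrite divr_gt0.
  by have := @le_ln1Dx R (b / a - 1); rewrite [1 + _]addrC subrK; apply; lra.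
rewrite ln_div ?posrE// -(ler_pM2l a0) => k1.
have e : a * (b / a - 1) = b - a by field; rewrite gt_eqF.
rewrite e in k1.
rewrite /log2 -mulrBl mulrA -(ler_pM2r l2) divfK ?gt_eqF//.
have k2 : (b - a) * 2^-1 <= (b - a) * ln 2.
  by apply: ler_wpM2l; [lra|exact: ln2_ge_half].
by lra.
Qed.

Lemma log2_div (R : realType) (a b : R) : 0 < a -> 0 < b ->
  log2 (a / b) = log2 a - log2 b.
Proof. by move=> a0 b0; rewrite /log2 ln_div ?posrE// mulrBl. Qed.

Unset Implicit Arguments.

Theorem theorem2 (R : realType) (T : choiceType) (PXY : T * T -> R) (m : nat) :
  is_pmf PXY -> (1 <= m)%N ->
  let p := Pr PXY [set xy | xy.1 = xy.2] in
  (* conditional pmf of X given the event {X = Y} *)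
  let PX_eq := fun x : T => Pr PXY [set xy | xy.1 = x /\ xy.1 = xy.2] / p in
  exists (GA GB W1T W2T : choiceType) (PA : GA -> R) (PB : GB -> R)
         (w1 : T -> GA -> W1T) (w2 : T -> GB -> W1T -> W2T)
         (kA : T -> GA -> W1T -> W2T -> seq bool)
         (kB : T -> GB -> W1T -> W2T -> seq bool),
    is_pmf PA /\ is_pmf PB /\
    achieves2 PXY PA PB w1 w2 kA kB
      ((1 - p) / m%:R)
      (p%:E * (entropy PX_eq - (log2 (m%:R : R) + 2)%:E))%E.
Proof.
move=> PXY1 m0 p PX_eq; have [P0 _] := PXY1.
have [h hP] := hash_exists PXY1 m0.
apply: (code_scheme_achieves PXY1 hP).
pose D x := PXY (x, x).
have PE x : PX_eq x = D x / p.
  rewrite /PX_eq (_ : [set _ | _] = [set (x, x)]) /Pr.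
    by rewrite esum_set1 ?lee_fin.
  by apply/seteqP; split=> [[a b] /= [-> <-]|_ ->].
have p0 : 0 <= p by exact: Pr_ge0.
(* Here the conditional law divides by zero, but the target length is 0 by the convention for
   [0 * x] on extended reals. *)
have [p00|pn0] := eqVneq p 0.
  by rewrite p00 mul0e; exact: trivial_scheme.
have {pn0}pp : 0 < p by rewrite lt_neqAle eq_sym pn0 p0.
have p1 : p <= 1.
  by rewrite -lee_fin Pr_EFin//; exact: esum_le1.
have pE : p%:E = (\esum_(x in [set: T]) (D x)%:E)%E.
  rewrite Pr_EFin// -(esum_image setT (fun x => (x, x)) (fun xy => (PXY xy)%:E));
    last first.
    by move=> x y _ _ [].
  congr (esum _ _); apply/seteqP; split=> [[x y] /= <-|_ [x _ <-]//].
  by exists x.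
have D0 x : 0 <= D x by exact: P0.
have Dp x : D x <= p.
  rewrite -lee_fin pE; apply: (@le_trans _ _ (\esum_(y in [set x]) (D y)%:E)%E).
    by rewrite esum_set1 ?lee_fin.
  by apply: subset_esum => // y _; rewrite lee_fin.
pose t x : R := - (D x / p * log2 (D x / p)).
have t0 x : 0 <= t x.
  apply: neg_xlog2_ge0; rewrite divr_ge0//= ler_pdivrMr// mul1r; exact: Dp.
have HE : entropy PX_eq = (\esum_(x in [set: T]) (t x)%:E)%E.
  by apply: eq_esum => x _; rewrite PE.
have tE x : 0 < D x -> t x = p^-1 * (- (D x * log2 (D x))) + D x / p * log2 p.
  by move=> Dx; rewrite /t log2_div//; ring.
have [Hoo|Hfin] := eqVneq (entropy PX_eq) +oo%E.
  apply: (@code_scheme_le _ _ _ _ _ _ +oo%E); first exact: leey.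
  apply: uniform_scheme => //.
  (* Since [log2 p <= 0], undoing the normalization by [p] shows that the conditional entropy is at
     most [p^-1] times the entropy sum of [D], so the latter is infinite too. *)
  apply/eqP; rewrite -leye_eq leNgt; apply/negP => fin.
  have e0 x : 0 <= - (D x * log2 (D x)).
    by apply: neg_xlog2_ge0; rewrite D0 (le_trans (Dp x)).
  suff : (entropy PX_eq < +oo)%E by rewrite Hoo.
  apply: (@le_lt_trans _ _ (p^-1%:E * \esum_(x in [set: T])
    (- (D x * log2 (D x)))%:E)%E); last first.
    by apply: lte_mul_pinfty; rewrite ?lee_fin ?invr_ge0.
  rewrite HE -esumZl ?invr_ge0//.
  apply: le_esum => x _; rewrite lee_fin.
  have := D0 x; rewrite le_eqVlt => /predU1P[Dx|Dx].
    by rewrite /t -Dx !mul0r oppr0 mulr0.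
  rewrite tE// gerDl mulr_ge0_le0// ?divr_ge0// /log2.
  by rewrite mulr_le0_ge0 ?ln_le0// invr_ge0 ln_ge0// ler1n.
have Hfn : entropy PX_eq \is a fin_num.
  rewrite ge0_fin_numE ?ltey// HE; by apply: esum_ge0 => x _; rewrite lee_fin.
have [x0 Dx0] : exists x0, 0 < D x0.
  apply: contrapT => /forallNP nD; move: pp; rewrite -lte_fin pE esum1 ?ltxx// => x _.
  have := D0 x; rewrite le_eqVlt => /predU1P[<-//|Dx]; by case: (nD x).
(* The tolerance costs [D x0] once multiplied by [p]. Adding [x0] to the finite set gives
   [D x0 <= pF], which is what repays it. *)
have [|X [X' [finX XT] <-] Xlt] := @ub_ereal_sup_adherent R _ (D x0 / p) _ Hfn.
  by rewrite divr_gt0.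
rewrite -/(esum setT (fun x => (- (PX_eq x * log2 (PX_eq x)))%:E)) -/(entropy PX_eq) in Xlt.
pose s := [seq x <- undup (x0 :: fset_set X') | 0 < D x].
have us : uniq s by rewrite filter_uniq// undup_uniq.
have sD : {in s, forall x, 0 < D x} by move=> x; rewrite mem_filter => /andP[].
have x0s : x0 \in s by rewrite mem_filter Dx0 mem_undup inE eqxx.
have s0 : s != [::] by apply: contraTneq x0s => ->.
pose eF := \sum_(x <- s) t x; pose pF := \sum_(x <- s) D x.
have eFE : entropy PX_eq = (fine (entropy PX_eq))%:E by rewrite fineK.
set e := fine _ in eFE.
have le_eF : e - D x0 / p <= eF.
  rewrite -lee_fin EFinB -eFE; apply: le_trans (ltW Xlt) _.
  rewrite (_ : (\sum_(x \in X') _)%E = \esum_(x in X') (t x)%:E)%E; last first.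
    rewrite esum_fset//; last by move=> x _; rewrite lee_fin.
    by apply: eq_fsbigr => x _; rewrite PE.
  rewrite /eF -sumEFin -esum_seq//.
  rewrite (esumID [set x | 0 < D x]); last by move=> x _; rewrite lee_fin.
  rewrite [X in (_ + X)%E]esum1 ?adde0.
    apply: subset_esum => [x [Xx Dx]|x _]; last by rewrite lee_fin.
    by rewrite /= mem_filter Dx mem_undup inE in_fset_set// mem_set// orbT.
  move=> x [_ /= /negP]; rewrite -leNgt => Dx.
  by rewrite /t (_ : D x = 0) ?mul0r ?oppr0//; apply/eqP; rewrite eq_le Dx D0.
have pF_ge : D x0 <= pF.
  rewrite /pF (perm_big _ (perm_to_rem x0s)) big_cons lerDl big_seq sumr_ge0//.
have pF_le : pF <= p.
  rewrite -lee_fin pE /pF -sumEFin -esum_seq//; apply: subset_esum => // x _.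
  by rewrite lee_fin.
apply: code_scheme_le (huffman_scheme h PXY1 m0 s0 us sD).
rewrite eFE -EFinB -EFinM lee_fin -/pF.
have pF0 : 0 < pF by lra.
have m0' : 0 < m%:R :> R by rewrite ltr0n.
have eFp : p * eF = - \sum_(x <- s) D x * log2 (D x) + pF * log2 p.
  rewrite /eF /pF mulr_sumr mulr_suml -sumrN -big_split /=; apply: eq_big_seq => x /sD Dx.
  by rewrite tE//; field; rewrite gt_eqF.
have lm : 0 <= log2 (m%:R : R).
  by rewrite /log2 divr_ge0// ln_ge0 ?ler1n.
(* The losses are [pF] from Huffman, at most [2 * (p - pF)] from the normalization and at most
   [D x0] from the truncated entropy; as [D x0 <= pF], they add up to at most [2 * p]. *)
have := xlog2_ratio_ge pF0 pF_le; rewrite log2_div// => r1.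
have r2 : pF * log2 m%:R <= p * log2 (m%:R : R) by apply: ler_wpM2r.
have r3 : p * e <= p * eF + D x0.
  have := le_eF; rewrite -(ler_pM2l pp) mulrBr [p * (D x0 / p)]mulrC divfK ?gt_eqF//; lra.
rewrite !mulrBr mulrDr; lra.
Qed.
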